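(* Let $W(x)$ be an $N\times N$ weight matrix. The algebra $\mathcal D(W)$ is full if and only if there exist $W$-symmetric elements $\mathfrak V_1,\mathfrak V_2,\dots,\mathfrak V_N$ in $\mathcal D(W)$ (nonzero) satisfying $\mathfrak V_i\mathfrak V_j=0$ for $i\ne j$ with $\mathfrak V_1+\dots+\mathfrak V_N$ a central element of $\mathcal D(W)$ which is not a zero divisor.
   Context: Differential operators act on the right: $M_N(\Omega[x])$ is the algebra of matrix differential operators $\mathfrak D=\sum_j\partial_x^jA_j(x)$ with $A_j\in M_N(\mathbb C[x])$, acting on matrix functions by $F\cdot\mathfrak D=\sum_jF^{(j)}A_j$, with product determined by $F\cdot(\mathfrak D\mathfrak E)=(F\cdot\mathfrak D)\cdot\mathfrak E$. A weight matrix $W$ supported on an interval $(x_0,x_1)$ (possibly infinite) is a Hermitian matrix-valued function $W:\mathbb R\to M_N(\mathbb C)$, zero outside $(x_0,x_1)$, entrywise smooth and positive definite on $(x_0,x_1)$, with finite moments $\int x^mW(x)dx$ for all $m\ge0$. It defines $\langle P,Q\rangle_W=\int P(x)W(x)Q(x)^*dx$ for $P,Q\in M_N(\mathbb C[x])$. The sequence of monic orthogonal polynomials $P(x,n)$, $n\ge0$, of $W$ is the unique sequence in $M_N(\mathbb C[x])$ with $P(x,n)$ of degree $n$ and leading coefficient $I$, and $\langle P(x,n),P(x,m)\rangle_W=0$ for $m\ne n$. $\mathcal D(W)$ is the algebra of all $\mathfrak D\in M_N(\Omega[x])$ for which there are matrices $\Lambda(n)\in M_N(\mathbb C)$ with $P(x,n)\cdot\mathfrak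 D=\Lambda(n)P(x,n)$ for all $n\geq0$. An operator $\mathfrak D\in\mathcal D(W)$ is $W$-symmetric if $\langle P\cdot\mathfrak D,Q\rangle_W=\langle P,Q\cdot\mathfrak D\rangle_W$ for all $P,Q\in M_N(\mathbb C[x])$. Fullness: let $\mathcal Z(W)$ be the center of $\mathcal D(W)$, $\mathcal F(W)$ its total ring of fractions, $\mathcal P_1(W),\dots,\mathcal P_r(W)$ its minimal primes and $\mathcal F_i(W)$ the localization of $\mathcal Z(W)$ at $\mathcal P_i(W)$ (a field). There is an algebra isomorphism $\mathcal D(W)\otimes_{\mathcal Z(W)}\mathcal F(W)\cong\bigoplus_{i=1}^rM_{n_i}(\mathcal F_i(W))$ for uniquely determined positive integers $n_i$; $\mathcal D(W)$ is called full if $n_1+\dots+n_r=N$. *)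

(* Defs.v *)
From HB Require Import structures.
From mathcomp Require Import all_boot all_order all_algebra.
From mathcomp Require Import sesquilinear spectral ring_quotient complex.
From mathcomp Require Import all_classical all_reals all_analysis.
From mathcomp Require Import ring.

Set Implicit Arguments.
Unset Strict Implicit.
Unset Printing Implicit Defensive.

Import Order.TTheory GRing.Theory Num.Theory.
Import numFieldNormedType.Exports.

Local Open Scope ring_scope.

(* The polynomial d stands for the operator \sum_j \partial_x^j d`_j : the
   outer variable is \partial_x, written to the left of its coefficient. *)
Definition weyl (K : numFieldType) : Type := {poly {poly K}}.

Section Weyl.
Variable K : numFieldType.

HB.instance Definition _ :=
  GRing.Zmodule.copy (weyl K) {poly {poly K}}.

Implicit Types (d e : weyl K) (f g : {poly K}).

Definition wcoef d (j : nat) : {poly K} := (d : {poly {poly K}})`_j.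

Definition wact f d : {poly K} :=
  \sum_(j < size (d : {poly {poly K}})) derivn j f * wcoef d j.

(* (\partial^i a)(\partial^j b) =
     \sum_k 'C(j, k) \partial^(i + k) a^(j - k) b, by the Leibniz rule applied
   to (f^(i) a)^(j) b. *)
Definition wmul d e : weyl K :=
  \sum_(i < size (d : {poly {poly K}}))
   \sum_(j < size (e : {poly {poly K}}))
    \sum_(k < j.+1)
      (derivn (j - k) (wcoef d i) * wcoef e j *+ 'C(j, k)) *:
        ('X^(i + k) : {poly {poly K}}).

Definition wone : weyl K := (1 : {poly {poly K}}).

Lemma wcoefD d e j : wcoef (d + e) j = wcoef d j + wcoef e j.
Proof. exact: coefD. Qed.

Lemma wactE n f d : (size (d : {poly {poly K}}) <= n)%N ->
  wact f d = \sum_(j < n) derivn j f * wcoef d j.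
Proof.
move=> le_dn; rewrite /wact (big_ord_widen _ (fun j => derivn j f * wcoef d j) le_dn).
rewrite big_mkcond; apply: eq_bigr => j _; case: ltnP => // /(nth_default 0) d0.
by rewrite /wcoef d0 mulr0.
Qed.

Lemma wactDr f d e : wact f (d + e) = wact f d + wact f e.
Proof.
pose n := maxn (size (d : {poly {poly K}})) (size (e : {poly {poly K}})).
rewrite (@wactE n f d) ?leq_maxl // (@wactE n f e) ?leq_maxr //.
rewrite (@wactE n) ?(leq_trans (size_polyD _ _)) // -big_split /=.
by apply: eq_bigr => j _; rewrite wcoefD mulrDr.
Qed.

Lemma wact0r f : wact f 0 = 0.
Proof. by rewrite /wact size_poly0 big_ord0. Qed.

Lemma wactNr f d : wact f (- d) = - wact f d.
Proof. by apply/eqP; rewrite -addr_eq0 -wactDr addNr wact0r. Qed.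

Lemma wact_sumr f (I : Type) (r : seq I) (P : pred I) (F : I -> weyl K) :
  wact f (\sum_(i <- r | P i) F i) = \sum_(i <- r | P i) wact f (F i).
Proof. exact: (big_morph _ (wactDr f) (wact0r f)). Qed.

Lemma wactDl f g d : wact (f + g) d = wact f d + wact g d.
Proof.
by rewrite /wact -big_split /=; apply: eq_bigr => j _; rewrite derivnD mulrDl.
Qed.

Lemma wact0l d : wact 0 d = 0.
Proof. by rewrite /wact big1 // => j _; rewrite linear0 mul0r. Qed.

Lemma wactZl (c : K) f d : wact (c *: f) d = c *: wact f d.
Proof.
rewrite /wact scaler_sumr; apply: eq_bigr => j _.
by rewrite derivnZ scalerAl.
Qed.

Lemma wact_suml (I : Type) (r : seq I) (P : pred I) (F : I -> {poly K}) d :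
  wact (\sum_(i <- r | P i) F i) d = \sum_(i <- r | P i) wact (F i) d.
Proof. by apply: (big_morph (wact^~ d) (fun f g => wactDl f g d) (wact0l d)). Qed.

Lemma wactXn f (a : {poly K}) m :
  wact f (a *: ('X^m : {poly {poly K}})) = derivn m f * a.
Proof.
rewrite (@wactE m.+1); last by rewrite (leq_trans (size_scale_leq _ _)) ?size_polyXn.
rewrite big_ord_recr big1 /= => [|j _].
  by rewrite add0r /wcoef coefZ coefXn eqxx mulr1.
by rewrite /wcoef coefZ coefXn (ltn_eqF (ltn_ord j)) !mulr0.
Qed.

Lemma wact1 f : wact f wone = f.
Proof.
have -> : wone = 1 *: ('X^0 : {poly {poly K}}) by rewrite scale1r expr0.
by rewrite wactXn mulr1.
Qed.

Lemma derivnM_Leibniz n f g :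
  derivn n (f * g) =
    \sum_(k < n.+1) (derivn k f * derivn (n - k) g) *+ 'C(n, k).
Proof.
elim: n => [|n IHn]; first by rewrite big_ord1.
rewrite derivnS IHn raddf_sum /=.
under eq_bigr => k _.
  rewrite derivMn derivM -!derivnS mulrnDl -subSn ?(ltnSE (ltn_ord k)) //.
  over.
rewrite big_split /= addrC.
transitivity (\sum_(k < n.+2) (derivn k f * derivn (n.+1 - k) g) *+ 'C(n, k) +
  \sum_(k < n.+1) (derivn k.+1 f * derivn (n - k) g) *+ 'C(n, k)).
  by congr (_ + _); rewrite [RHS]big_ord_recr /= bin_small // mulr0n addr0.
rewrite big_ord_recl [RHS]big_ord_recl !bin0 -addrA -big_split /=; congr (_ + _).
by apply: eq_bigr => k _; rewrite /bump /= add1n subSS binS mulrnDr.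
Qed.

Lemma wact_mul f d e : wact f (wmul d e) = wact (wact f d) e.
Proof.
rewrite /wmul wact_sumr [X in _ = wact X _]/wact wact_suml; apply: eq_bigr => i _.
rewrite wact_sumr [RHS]/wact; apply: eq_bigr => j _.
rewrite wact_sumr derivnM_Leibniz mulr_suml; apply: eq_bigr => k _.
rewrite wactXn !mulrnAr !mulrnAl -mulrA; congr (_ * _ *+ _).
by rewrite /derivn addnC iterD.
Qed.

Lemma wact_inj d e : (forall f, wact f d = wact f e) -> d = e.
Proof.
move=> eq_de; apply/eqP; rewrite -subr_eq0; apply/eqP.
have {eq_de} : forall f, wact f (d - e) = 0.
  by move=> f; rewrite wactDr wactNr eq_de subrr.
move: (d - e) => {d e} d d0; apply/polyP => j; rewrite coef0.
elim/ltn_ind: j => j IHj; pose n := maxn j.+1 (size (d : {poly {poly K}})).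
have := d0 'X^j; rewrite (@wactE n) ?leq_maxr //.
rewrite (bigD1 (Ordinal (leq_maxl j.+1 _ : j < n)%N)) //= big1 => [|i neq_ij].
  rewrite addr0 derivnXn subnn expr0 ffactnn mulrnAl mul1r /wcoef.
  move/eqP; rewrite -(@scaler_nat K) -mul_polyC mulf_eq0 polyC_eq0 pnatr_eq0.
  by rewrite gtn_eqF ?fact_gt0 //= => /eqP.
case: (ltngtP i j) => [/IHj d_i0|lt_ji|eq_ij].
- by rewrite /wcoef d_i0 mulr0.
- by rewrite derivnXn ffact_small // mulr0n mul0r.
- by case/negP: neq_ij; apply/eqP/val_inj.
Qed.

Fact wmulA : associative wmul.
Proof. by move=> d e g; apply: wact_inj => f; rewrite !wact_mul. Qed.
Fact wmul1l : left_id wone wmul.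
Proof. by move=> d; apply: wact_inj => f; rewrite !wact_mul wact1. Qed.
Fact wmul1r : right_id wone wmul.
Proof. by move=> d; apply: wact_inj => f; rewrite !wact_mul wact1. Qed.
Fact wmulDl : left_distributive wmul +%R.
Proof.
by move=> d e g; apply: wact_inj => f; rewrite wactDr !wact_mul wactDr wactDl.
Qed.
Fact wmulDr : right_distributive wmul +%R.
Proof. by move=> d e g; apply: wact_inj => f; rewrite wactDr !wact_mul wactDr. Qed.
Fact wone_neq0 : wone != 0.
Proof. exact: (oner_neq0 {poly {poly K}}). Qed.

HB.instance Definition _ := GRing.Zmodule_isNzRing.Build (weyl K)
  wmulA wmul1l wmul1r wmulDl wmulDr wone_neq0.

Lemma wactM f d e : wact f (d * e) = wact (wact f d) e.
Proof. exact: wact_mul. Qed.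

End Weyl.

Arguments wcoef {K} d j.

(* An n x n matrix differential operator is an element of 'M[weyl K]_n; it acts
   on the right of matrix polynomials. *)
Section MatrixOperators.
Variables (K : numFieldType) (n : nat).
Implicit Types (F : 'M[{poly K}]_n) (D E : 'M[weyl K]_n).

Definition mxact F D : 'M[{poly K}]_n :=
  \matrix_(i, k) \sum_j wact (F i j) (D j k).

Lemma mxact_coefE m F D :
    (forall i j, size (D i j : {poly {poly K}}) <= m)%N ->
  mxact F D = \sum_(j < m) map_mx (derivn j) F *m map_mx (wcoef^~ j) D.
Proof.
move=> leDm; apply/matrixP=> i k; rewrite !mxE summxE.
under [RHS]eq_bigr => j _ do rewrite mxE.
rewrite exchange_big /=; apply: eq_bigr => l _.
by rewrite (wactE _ (leDm _ _)); apply: eq_bigr => j _; rewrite !mxE.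
Qed.

Lemma mxactM F D E : mxact F (D *m E) = mxact (mxact F D) E.
Proof.
apply/matrixP=> i k; rewrite !mxE.
under eq_bigr => j _ do rewrite mxE wact_sumr.
rewrite exchange_big /=; apply: eq_bigr => l _.
by rewrite mxE wact_suml; apply: eq_bigr => j _; rewrite wactM.
Qed.

Lemma mxactB F D E : mxact F (D - E) = mxact F D - mxact F E.
Proof.
apply/matrixP=> i k; rewrite !mxE -sumrB; apply: eq_bigr => j _.
by rewrite !mxE wactDr wactNr.
Qed.

Lemma mxact1 F : mxact F 1%:M = F.
Proof.
apply/matrixP=> i k; rewrite mxE (bigD1 k) //= big1 => [|j neq_jk].
  by rewrite mxE eqxx mulr1n wact1 addr0.
by rewrite mxE (negPf neq_jk) mulr0n wact0r.
Qed.

Lemma mxact_constl (L : 'M[K]_n) F D :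
  mxact (map_mx polyC L *m F) D = map_mx polyC L *m mxact F D.
Proof.
apply/matrixP=> i k; rewrite !mxE.
under eq_bigr => j _ do rewrite mxE wact_suml.
rewrite exchange_big /=; apply: eq_bigr => l _.
rewrite !mxE mulr_sumr; apply: eq_bigr => j _.
by rewrite !mul_polyC wactZl.
Qed.

End MatrixOperators.

Section Weights.
Variables (R : realType) (n : nat).
Local Notation C := R[i].
Local Open Scope sesquilinear_scope.
Local Open Scope complex_scope.

Definition smooth_on (x0 x1 : \bar R) (f : R -> R) : Prop :=
  forall (k : nat) (x : R), (x0 < x%:E < x1)%E -> derivable (derive1n k f) x 1.

Definition posdefmx (A : 'M[C]_n) : Prop :=
  forall u : 'rV[C]_n, u != 0 -> 0 < (u *m A *m u ^t*) 0 0.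

Definition weight_matrix (x0 x1 : \bar R) (W : R -> 'M[C]_n) : Prop :=
  [/\ (x0 < x1)%E /\ forall x, W x \is hermsymmx,
      forall x, ~~ (x0 < x%:E < x1)%E -> W x = 0,
      forall i j, smooth_on x0 x1 (fun x => complex.Re (W x i j)) /\
                  smooth_on x0 x1 (fun x => complex.Im (W x i j)),
      forall x, (x0 < x%:E < x1)%E -> posdefmx (W x)
    & forall (m : nat) i j,
        lebesgue_measure.-integrable setT
          (fun x => (x ^+ m * complex.Re (W x i j))%:E) /\
        lebesgue_measure.-integrable setT
          (fun x => (x ^+ m * complex.Im (W x i j))%:E)].

Definition cintegral (f : R -> C) : C :=
  Rintegral lebesgue_measure setT (fun x => complex.Re (f x)) +i*
  Rintegral lebesgue_measure setT (fun x => complex.Im (f x)).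

Definition mxeval (P : 'M[{poly C}]_n) (x : R) : 'M[C]_n :=
  map_mx (fun p : {poly C} => p.[x%:C]) P.

Definition wdot (W : R -> 'M[C]_n) (P Q : 'M[{poly C}]_n) : 'M[C]_n :=
  \matrix_(i, j) cintegral (fun x =>
    (mxeval P x *m W x *m (mxeval Q x) ^t*) i j).

Definition monic_orthogonal (W : R -> 'M[C]_n) (P : nat -> 'M[{poly C}]_n) :
    Prop :=
  [/\ forall m, map_mx (fun p : {poly C} => p`_m) (P m) = 1%:M,
      forall m i j, (size (P m i j) <= m.+1)%N
    & forall m l, m != l -> wdot W (P m) (P l) = 0].

(* For a weight matrix on a nonempty interval there is exactly one such
   sequence, so that the choice operator is a definite description here. *)
Definition monicOP (W : R -> 'M[C]_n) : nat -> 'M[{poly C}]_n :=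
  xget (fun=> 0) [set P | monic_orthogonal W P]%classic.

Definition bispectral (W : R -> 'M[C]_n) : {pred 'M[weyl C]_n} :=
  [pred D | `[< exists Lambda : nat -> 'M[C]_n, forall m,
     mxact (monicOP W m) D = map_mx polyC (Lambda m) *m monicOP W m >]].

End Weights.

Section DAlgebra.
Variables (R : realType) (n : nat) (W : R -> 'M[R[i]]_n.+1).

Fact bispectral_subring : subring_closed (bispectral W).
Proof.
split=> [|D E /asboolP[L HL] /asboolP[M HM]|D E /asboolP[L HL] /asboolP[M HM]].
- apply/asboolP; exists (fun=> 1%:M) => m.
  by rewrite [1]/(1%:M) mxact1 map_mx1 mul1mx.
- apply/asboolP; exists (fun m => L m - M m) => m.
  by rewrite mxactB HL HM map_mxB mulmxBl.
- apply/asboolP; exists (fun m => L m *m M m) => m.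
  by rewrite [D * E]/(D *m E) mxactM HL mxact_constl HM map_mxM mulmxA.
Qed.

Record DW : Type := MkDW { DW_op :> 'M[weyl R[i]]_n.+1; _ : DW_op \in bispectral W }.

HB.instance Definition _ := [isSub for DW_op].
HB.instance Definition _ := [Choice of DW by <:].
HB.instance Definition _ :=
  GRing.SubChoice_isSubNzRing.Build _ _ DW bispectral_subring.

Definition Wsymmetric (D : DW) : Prop :=
  forall P Q : 'M[{poly R[i]}]_n.+1, wdot W (mxact P D) Q = wdot W P (mxact Q D).

End DAlgebra.

Definition central (A : nzRingType) : {pred A} :=
  [pred z | `[< forall a : A, z * a = a * z >]].
Arguments central : clear implicits.

Section Center.
Variable A : nzRingType.

Fact central_subring : subring_closed (central A).
Proof.
split=> [|x y /asboolP Hx /asboolP Hy|x y /asboolP Hx /asboolP Hy]; apply/asboolP => a.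
- by rewrite mul1r mulr1.
- by rewrite mulrBl mulrBr Hx Hy.
- by rewrite -mulrA Hy mulrA Hx mulrA.
Qed.

Record center : Type := MkCenter { center_val :> A; _ : center_val \in central A }.

HB.instance Definition _ := [isSub for center_val].
HB.instance Definition _ := [Choice of center by <:].
HB.instance Definition _ :=
  GRing.SubChoice_isSubNzRing.Build _ _ center central_subring.

Lemma centerP (z : center) (a : A) : val z * a = a * val z.
Proof. by case: z => z /= /asboolP ->. Qed.

Fact center_mulC : commutative (@GRing.mul center).
Proof. by move=> x y; apply: val_inj; rewrite /= centerP. Qed.

HB.instance Definition _ :=
  GRing.PzRing_hasCommutativeMul.Build center center_mulC.

End Center.

Section Localization.
Variables (Z : comPzRingType) (S : mulrClosed Z).

Definition fracpair : Type := (Z * {s : Z | s \in S})%type.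
HB.instance Definition _ := Choice.on fracpair.
Implicit Types x y z : fracpair.

Definition fnum x : Z := x.1.
Definition fden x : Z := val x.2.
Fact fdenP x : fden x \in S. Proof. exact: (valP x.2). Qed.

Definition mkfrac (a s : Z) (sS : s \in S) : fracpair := (a, exist _ s sS).

Definition loc_rel x y : bool :=
  `[< exists2 u : Z, u \in S & u * (fnum x * fden y - fnum y * fden x) = 0 >].

Fact loc_rel_equiv : equiv_class_of loc_rel.
Proof.
split=> [x|x y|y x z].
- by apply/asboolP; exists 1; rewrite ?rpred1 // subrr mulr0.
- by apply/asboolP/asboolP => -[u uS e]; exists u => //; rewrite -opprB mulrN e oppr0.
- move=> /asboolP[u uS exy] /asboolP[v vS eyz].
  apply/asboolP; exists (u * v * fden y); first by rewrite !rpredM ?fdenP.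
  transitivity (v * fden z * (u * (fnum x * fden y - fnum y * fden x)) +
                u * fden x * (v * (fnum y * fden z - fnum z * fden y))).
    by ring.
  by rewrite exy eyz !mulr0 addr0.
Qed.
Canonical loc_rel_canonical := EquivRelPack loc_rel_equiv.

Definition loc : Type := {eq_quot loc_rel}%qT.
HB.instance Definition _ : EqQuotient _ loc_rel loc := EqQuotient.on loc.
HB.instance Definition _ := Choice.on loc.

Local Notation cls x := (\pi_loc x)%qT.

Fact loc_eq x y (u : Z) : u \in S ->
  u * (fnum x * fden y - fnum y * fden x) = 0 -> cls x = cls y.
Proof. by move=> uS e; apply/eqmodP/asboolP; exists u. Qed.

Fact loc_reprP x : exists2 u : Z, u \in S &
  u * (fnum x * fden (repr (cls x)) - fnum (repr (cls x)) * fden x) = 0.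
Proof.
by have /eqmodP/asboolP : cls x = cls (repr (cls x)) by rewrite reprK.
Qed.

Definition fadd x y := mkfrac (fnum x * fden y + fnum y * fden x)
  (rpredM (fdenP x) (fdenP y)).
Definition fopp x := mkfrac (- fnum x) (fdenP x).
Definition fmul x y := mkfrac (fnum x * fnum y) (rpredM (fdenP x) (fdenP y)).
Definition fconst (a : Z) := mkfrac a (rpred1 S).

Definition loc_add (p q : loc) : loc := cls (fadd (repr p) (repr q)).
Definition loc_opp (p : loc) : loc := cls (fopp (repr p)).
Definition loc_mul (p q : loc) : loc := cls (fmul (repr p) (repr q)).
Definition loc_of (a : Z) : loc := cls (fconst a).

Fact faddE x y : (fnum (fadd x y) = fnum x * fden y + fnum y * fden x)%R *
  (fden (fadd x y) = fden x * fden y)%R.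
Proof. by []. Qed.
Fact foppE x : (fnum (fopp x) = - fnum x)%R * (fden (fopp x) = fden x)%R.
Proof. by []. Qed.
Fact fmulE x y : (fnum (fmul x y) = fnum x * fnum y)%R *
  (fden (fmul x y) = fden x * fden y)%R.
Proof. by []. Qed.
Fact fconstE a : (fnum (fconst a) = a)%R * (fden (fconst a) = 1)%R.
Proof. by []. Qed.
Let fracE := (faddE, foppE, fmulE, fconstE).

Fact loc_addE x y : loc_add (cls x) (cls y) = cls (fadd x y).
Proof.
have [u uS eu] := loc_reprP x; have [v vS ev] := loc_reprP y.
apply: (@loc_eq _ _ (u * v)); first exact: rpredM.
set x' := repr (cls x) in eu *; set y' := repr (cls y) in ev *.
rewrite !fracE.
transitivity (- (v * fden y * fden y' * (u * (fnum x * fden x' - fnum x' * fden x)) +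
               u * fden x * fden x' * (v * (fnum y * fden y' - fnum y' * fden y)))).
  by ring.
by rewrite eu ev !mulr0 addr0 oppr0.
Qed.

Fact loc_oppE x : loc_opp (cls x) = cls (fopp x).
Proof.
have [u uS eu] := loc_reprP x; apply: (@loc_eq _ _ u) => //.
set x' := repr (cls x) in eu *.
rewrite !fracE -[RHS]eu; ring.
Qed.

Fact loc_mulE x y : loc_mul (cls x) (cls y) = cls (fmul x y).
Proof.
have [u uS eu] := loc_reprP x; have [v vS ev] := loc_reprP y.
apply: (@loc_eq _ _ (u * v)); first exact: rpredM.
set x' := repr (cls x) in eu *; set y' := repr (cls y) in ev *.
rewrite !fracE.
transitivity (- (v * fnum y * fden y' * (u * (fnum x * fden x' - fnum x' * fden x)) +
               u * fden x * fnum x' * (v * (fnum y * fden y' - fnum y' * fden y)))).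
  by ring.
by rewrite eu ev !mulr0 addr0 oppr0.
Qed.

Local Ltac loc_ring :=
  rewrite ?(loc_addE, loc_mulE); apply: (@loc_eq _ _ 1);
    [exact: rpred1 | rewrite !fracE; ring].

Fact loc_addA : associative loc_add.
Proof.
elim/quotW=> x; elim/quotW=> y; elim/quotW=> z.
rewrite (loc_addE y z) (loc_addE x y); loc_ring.
Qed.
Fact loc_addC : commutative loc_add.
Proof. elim/quotW=> x; elim/quotW=> y; loc_ring. Qed.
Fact loc_add0 : left_id (loc_of 0) loc_add.
Proof. elim/quotW=> x; rewrite /loc_of; loc_ring. Qed.
Fact loc_addN : left_inverse (loc_of 0) loc_opp loc_add.
Proof. elim/quotW=> x; rewrite loc_oppE /loc_of; loc_ring. Qed.

HB.instance Definition _ :=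
  GRing.isZmodule.Build loc loc_addA loc_addC loc_add0 loc_addN.

Fact loc_mulA : associative loc_mul.
Proof.
elim/quotW=> x; elim/quotW=> y; elim/quotW=> z.
rewrite (loc_mulE y z) (loc_mulE x y); loc_ring.
Qed.
Fact loc_mulC : commutative loc_mul.
Proof. elim/quotW=> x; elim/quotW=> y; loc_ring. Qed.
Fact loc_mul1 : left_id (loc_of 1) loc_mul.
Proof. elim/quotW=> x; rewrite /loc_of; loc_ring. Qed.
Fact loc_mulD : left_distributive loc_mul loc_add.
Proof.
elim/quotW=> x; elim/quotW=> y; elim/quotW=> z.
rewrite (loc_addE x y) (loc_mulE x z) (loc_mulE y z); loc_ring.
Qed.

HB.instance Definition _ := GRing.Zmodule_isComPzRing.Build loc
  loc_mulA loc_mulC loc_mul1 loc_mulD.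

Fact loc_of_is_zmod_morphism : zmod_morphism loc_of.
Proof.
move=> a b.
transitivity (loc_add (cls (fconst a)) (loc_opp (cls (fconst b)))); last by [].
rewrite loc_oppE /loc_of; loc_ring.
Qed.
Fact loc_of_is_monoid_morphism : GRing.monoid_morphism loc_of.
Proof.
split=> // a b.
transitivity (loc_mul (cls (fconst a)) (cls (fconst b))); last by [].
rewrite /loc_of; loc_ring.
Qed.

HB.instance Definition _ :=
  GRing.isZmodMorphism.Build Z loc loc_of loc_of_is_zmod_morphism.
HB.instance Definition _ :=
  GRing.isMonoidMorphism.Build Z loc loc_of loc_of_is_monoid_morphism.

End Localization.

Section TotalFractions.
Variable Z : comPzRingType.

Definition regular (z : Z) : bool := `[< GRing.lreg z >].

Fact regular_mulr_closed : GRing.mulr_closed regular.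
Proof.
split=> [|x y /asboolP Hx /asboolP Hy]; apply/asboolP; first exact: lreg1.
exact: lregM.
Qed.
HB.instance Definition _ := GRing.isMulClosed.Build Z regular regular_mulr_closed.

Definition totfrac : comPzRingType :=
  loc (GRing.MulClosed.clone Z regular _).
Definition totfrac_of : {rmorphism Z -> totfrac} :=
  @loc_of Z (GRing.MulClosed.clone Z regular _).

End TotalFractions.

Section LocalizationAtPrime.
Variables (Z : comNzRingType) (P : prime_idealr Z).

Definition prime_compl (z : Z) : bool := z \notin P.

Fact prime_compl_mulr_closed : GRing.mulr_closed prime_compl.
Proof.
have E z : (z \in prime_compl) = (z \notin P) by [].
split=> [|x y]; rewrite !E; first exact/negbT/(idealr1 P).
by move=> /negbTE Px /negbTE Py; apply/negbT; rewrite [LHS](prime_idealrM P) Px Py.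
Qed.
HB.instance Definition _ :=
  GRing.isMulClosed.Build Z prime_compl prime_compl_mulr_closed.

Definition loc_at : comPzRingType :=
  loc (GRing.MulClosed.clone Z prime_compl _).
Definition loc_at_of : {rmorphism Z -> loc_at} :=
  @loc_of Z (GRing.MulClosed.clone Z prime_compl _).

End LocalizationAtPrime.

Definition minimal_prime (Z : comNzRingType) (P : prime_idealr Z) : Prop :=
  forall Q : prime_idealr Z, {subset Q <= P} -> {subset P <= Q}.

(* The tensor product of A with a commutative algebra B over the center of A,
   whose structure map is iota.  The sequence [:: (a1, b1); ...; (ak, bk)]
   stands for a1 (x) b1 + ... + ak (x) bk. *)
Section Tensor.
Variables (A : nzRingType) (B : comPzRingType) (iota : {rmorphism center A -> B}).
Implicit Types s t : seq (A * B).

Inductive tens_cong : seq (A * B) -> seq (A * B) -> Prop :=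
| tens_refl s : tens_cong s s
| tens_sym s t : tens_cong s t -> tens_cong t s
| tens_trans s t u : tens_cong s t -> tens_cong t u -> tens_cong s u
| tens_cat s s' t t' :
    tens_cong s s' -> tens_cong t t' -> tens_cong (s ++ t) (s' ++ t')
| tens_catC s t : tens_cong (s ++ t) (t ++ s)
| tens_zero b : tens_cong [:: (0, b)] [::]
| tens_addl a a' b : tens_cong [:: (a + a', b)] [:: (a, b); (a', b)]
| tens_addr a b b' : tens_cong [:: (a, b + b')] [:: (a, b); (a, b')]
| tens_balanced a (z : center A) b :
    tens_cong [:: (a * val z, b)] [:: (a, iota z * b)].

Definition tens_rel s t : bool := `[< tens_cong s t >].

Fact tens_rel_equiv : equiv_class_of tens_rel.
Proof.
split=> [s|s t|t s u].
- by apply/asboolP; exact: tens_refl.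
- by apply/asboolP/asboolP; exact: tens_sym.
- by move=> /asboolP st /asboolP tu; apply/asboolP; exact: tens_trans tu.
Qed.
Canonical tens_rel_canonical := EquivRelPack tens_rel_equiv.

Definition tensor : Type := {eq_quot tens_rel}%qT.
HB.instance Definition _ : EqQuotient _ tens_rel tensor := EqQuotient.on tensor.
HB.instance Definition _ := Choice.on tensor.

Local Notation cls s := (\pi_tensor s)%qT.

Fact tens_eq s t : tens_cong s t -> cls s = cls t.
Proof. by move=> st; apply/eqmodP/asboolP. Qed.

Fact tens_reprP s : tens_cong (repr (cls s)) s.
Proof.
by have /eqmodP/asboolP : cls (repr (cls s)) = cls s by rewrite reprK.
Qed.

Definition topp s : seq (A * B) := [seq (- x.1, x.2) | x <- s].
Definition tmulx (x y : A * B) : A * B := (x.1 * y.1, x.2 * y.2).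
Definition tmul s t : seq (A * B) := [seq tmulx x y | x <- s, y <- t].

Definition tensor_add (p q : tensor) : tensor := cls (repr p ++ repr q).
Definition tensor_opp (p : tensor) : tensor := cls (topp (repr p)).
Definition tensor_mul (p q : tensor) : tensor := cls (tmul (repr p) (repr q)).
Definition pure_tensor (a : A) (b : B) : tensor := cls [:: (a, b)].

Fact tens_perm s t : perm_eq s t -> tens_cong s t.
Proof.
move=> /catCA_perm_ind ind; apply: (ind (tens_cong s)) (tens_refl s) => s1 s2 s3 ss.
apply: tens_trans ss _; rewrite !catA; apply: tens_cat (tens_refl _).
exact: tens_catC.
Qed.

Fact tens_map (f : A * B -> A * B) :
    (forall b, tens_cong [:: f (0, b)] [::]) ->
    (forall a a' b, tens_cong [:: f (a + a', b)] [:: f (a, b); f (a', b)]) ->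
    (forall a b b', tens_cong [:: f (a, b + b')] [:: f (a, b); f (a, b')]) ->
    (forall a (z : center A) b,
       tens_cong [:: f (a * val z, b)] [:: f (a, iota z * b)]) ->
  forall s t, tens_cong s t -> tens_cong (map f s) (map f t).
Proof.
move=> f0 fl fr fz s t; elim=> {s t} //=.
- by move=> s; exact: tens_refl.
- by move=> s t _; exact: tens_sym.
- by move=> s t u _ st _; exact: tens_trans.
- by move=> s s' t t' _ ss _ tt; rewrite !map_cat; exact: tens_cat.
- by move=> s t; rewrite !map_cat; exact: tens_catC.
Qed.

Fact tens_mulx_l y s t : tens_cong s t ->
  tens_cong (map (tmulx^~ y) s) (map (tmulx^~ y) t).
Proof.
apply: tens_map => [b|a a' b|a b b'|a z b]; rewrite /tmulx /=.
- by rewrite mul0r; exact: tens_zero.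
- by rewrite mulrDl; exact: tens_addl.
- by rewrite mulrDl; exact: tens_addr.
- by rewrite -(mulrA a) centerP (mulrA a) -(mulrA (iota z)); exact: tens_balanced.
Qed.

Fact tens_mulx_r x s t : tens_cong s t ->
  tens_cong (map (tmulx x) s) (map (tmulx x) t).
Proof.
apply: tens_map => [b|a a' b|a b b'|a z b]; rewrite /tmulx /=.
- by rewrite mulr0; exact: tens_zero.
- by rewrite mulrDr; exact: tens_addl.
- by rewrite mulrDr; exact: tens_addr.
- by rewrite mulrA (mulrCA _ (iota z)); exact: tens_balanced.
Qed.

Fact tens_opp s t : tens_cong s t -> tens_cong (topp s) (topp t).
Proof.
apply: tens_map => [b|a a' b|a b b'|a z b] /=.
- by rewrite oppr0; exact: tens_zero.
- by rewrite opprD; exact: tens_addl.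
- exact: tens_addr.
- by rewrite -mulNr; exact: tens_balanced.
Qed.

Fact tmul_cons s y t : tens_cong (tmul s (y :: t)) (map (tmulx^~ y) s ++ tmul s t).
Proof.
by apply: tens_perm; rewrite -cat1s /tmul perm_allpairs_catr allpairs1r.
Qed.

Fact tens_mul s s' t t' :
  tens_cong s s' -> tens_cong t t' -> tens_cong (tmul s t) (tmul s' t').
Proof.
move=> ss tt; apply: (tens_trans (t := tmul s t')).
  elim: s {ss} => [|x s IHs] /=; first exact: tens_refl.
  by apply: tens_cat => //; exact: tens_mulx_r.
elim: t' {tt} => [|y t' IHt].
  by rewrite /tmul !allpairs0r; exact: tens_refl.
apply: tens_trans (tmul_cons _ _ _) _; apply: tens_trans (tens_sym (tmul_cons _ _ _)).
by apply: tens_cat => //; exact: tens_mulx_l.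
Qed.

Fact tensor_addE s t : tensor_add (cls s) (cls t) = cls (s ++ t).
Proof. by apply/tens_eq/tens_cat; exact: tens_reprP. Qed.
Fact tensor_oppE s : tensor_opp (cls s) = cls (topp s).
Proof. by apply/tens_eq/tens_opp; exact: tens_reprP. Qed.
Fact tensor_mulE s t : tensor_mul (cls s) (cls t) = cls (tmul s t).
Proof. by apply/tens_eq/tens_mul; exact: tens_reprP. Qed.

Fact tensor_addA : associative tensor_add.
Proof.
elim/quotW=> s; elim/quotW=> t; elim/quotW=> u.
by rewrite (tensor_addE t u) (tensor_addE s t) !tensor_addE catA.
Qed.
Fact tensor_addC : commutative tensor_add.
Proof.
by elim/quotW=> s; elim/quotW=> t; rewrite !tensor_addE; apply/tens_eq/tens_catC.
Qed.
Fact tensor_add0 : left_id (cls [::]) tensor_add.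
Proof. by elim/quotW=> s; rewrite tensor_addE. Qed.
Fact tensor_addN : left_inverse (cls [::]) tensor_opp tensor_add.
Proof.
elim/quotW=> s; rewrite tensor_oppE tensor_addE; apply: tens_eq.
elim: s => [|[a b] s IHs] /=; first exact: tens_refl.
apply: (tens_trans (t := [:: (- a, b); (a, b)] ++ (topp s ++ s))).
  apply: tens_perm; rewrite /= perm_cons.
  by rewrite -cat1s perm_catCA.
rewrite -[[::]]cats0; apply: tens_cat => //.
apply: tens_trans (tens_sym (tens_addl _ _ _)) _; rewrite addNr; exact: tens_zero.
Qed.

HB.instance Definition _ :=
  GRing.isZmodule.Build tensor tensor_addA tensor_addC tensor_add0 tensor_addN.

Fact tensor_mulA : associative tensor_mul.
Proof.
elim/quotW=> s; elim/quotW=> t; elim/quotW=> u.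
rewrite (tensor_mulE t u) (tensor_mulE s t) !tensor_mulE.
congr (cls _); elim: s => //= x s IHs.
rewrite [in RHS]/tmul allpairs_cat -!/(tmul _ _) -IHs; congr (_ ++ _).
elim: t {IHs} => //= y t IHt; rewrite map_cat IHt; congr (_ ++ _).
by rewrite -map_comp; apply: eq_map => z; rewrite /tmulx /= !mulrA.
Qed.
Fact tensor_mul1 : left_id (pure_tensor 1 1) tensor_mul.
Proof.
elim/quotW=> s; rewrite tensor_mulE; congr (cls _); rewrite /tmul allpairs1l.
by rewrite -[RHS]map_id; apply: eq_map => -[a b]; rewrite /tmulx /= !mul1r.
Qed.
Fact tensor_1mul : right_id (pure_tensor 1 1) tensor_mul.
Proof.
elim/quotW=> s; rewrite tensor_mulE; congr (cls _); rewrite /tmul allpairs1r.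
by rewrite -[RHS]map_id; apply: eq_map => -[a b]; rewrite /tmulx /= !mulr1.
Qed.
Fact tensor_mulDl : left_distributive tensor_mul tensor_add.
Proof.
elim/quotW=> s; elim/quotW=> t; elim/quotW=> u.
rewrite (tensor_addE s t) (tensor_mulE s u) (tensor_mulE t u).
by rewrite tensor_mulE tensor_addE /tmul allpairs_cat.
Qed.
Fact tensor_mulDr : right_distributive tensor_mul tensor_add.
Proof.
elim/quotW=> s; elim/quotW=> t; elim/quotW=> u.
rewrite (tensor_addE t u) (tensor_mulE s t) (tensor_mulE s u).
rewrite tensor_mulE tensor_addE; apply/tens_eq/tens_perm.
by rewrite /tmul perm_allpairs_catr.
Qed.

HB.instance Definition _ := GRing.Zmodule_isPzRing.Build tensor
  tensor_mulA tensor_mul1 tensor_1mul tensor_mulDl tensor_mulDr.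

End Tensor.

Definition tensor_totfrac (A : nzRingType) : pzRingType :=
  tensor (totfrac_of (center A)).

(* The family Phi is an isomorphism of Z(A)-algebras from A (x)_Z(A) F onto the
   direct sum of the matrix algebras M_(n i)(F_i), given by its components.  As
   F is a localization of Z(A), it is automatically F-linear. *)
Definition full (A : nzRingType) (N : nat) : Prop :=
  exists (r : nat) (P : 'I_r -> prime_idealr (center A)) (n : 'I_r -> nat)
         (Phi : forall i, {rmorphism tensor_totfrac A -> 'M[loc_at (P i)]_(n i)}),
  [/\ [/\ forall i, minimal_prime (P i),
          forall i j, P i =i P j -> i = j
        & forall Q, minimal_prime Q -> exists i, Q =i P i],
      forall (z : center A) i,
        Phi i (pure_tensor _ (val z) 1) = (loc_at_of (P i) z)%:M,
      forall M : forall i, 'M[loc_at (P i)]_(n i),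
        exists! t, forall i, Phi i t = M i,
      forall i, (0 < n i)%N
    & (\sum_i n i = N)%N].

(* Main.v *)
From HB Require Import structures.
From mathcomp Require Import all_boot all_order all_algebra.
From mathcomp Require Import sesquilinear spectral ring_quotient complex.
From mathcomp Require Import all_classical all_reals all_analysis.
From mathcomp Require Import ring zify.
Require Import Defs.

(** Write A for D(W), Z for its center and N for the size of the matrices.  Two
    facts about A carry the theorem, and nothing else about A is used.

    - A acts faithfully on the right of the matrix polynomials, and adjunction for
      the inner product of W is an involution adj of A that is positive: D (adj D) = 0
      forces D = 0 (lemma adjoint_algebra).  An adjoint of D exists on the space of
      polynomials, by expanding in the orthogonal polynomials P(x, m), on which D is
      diagonal.  It is again a differential operator: an operator of order less than
      s is killed by s commutators with multiplication by x, multiplication by x is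
      self-adjoint, and conversely a map killed by s such commutators is a
      differential operator (lemma differential_operator).

    - A embeds in the N x N matrices over a field K, here the fractions of C[t]
      (lemma symbol_representation).  Comparing the coefficients of x^m in
      P(x, m) D = Lambda(m) P(x, m) shows that Lambda(m) is a polynomial in m, and
      D is determined by this matrix of polynomials.

    In M_N(K), a family of N pairwise orthogonal matrices with nonzero squares is
    simultaneously diagonalizable, each member becoming a nonzero multiple of a
    diagonal matrix unit (lemma orthogonal_family_diag).  In particular each member is of
    rank one.

    Let V_1, ..., V_N be symmetric, nonzero and pairwise orthogonal in A.  Positivity
    gives V_i V_i <> 0, so the lemma applies.  Say that i and j are connected when
    V_i A V_j <> 0; the adjoint makes this symmetric, and it is transitive because
    the V_i have rank one.  Products of elements that connect indices then yield
    elements x_ij of A that represent nonzero multiples u_i E_ij of all matrix units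
    inside the classes of connected indices, u_i depending only on the class, while
    every element of A is block diagonal for these classes (lemma frame_exists).
    From such a frame everything about A can be read off: central elements are the
    scalars on blocks, the sums of x_ki a x_jk over the class of i and j are central and
    recover the entries of a, the minimal primes of Z are the kernels of the
    characters of Z attached to the blocks, and A (x) F becomes the direct sum of
    full matrix algebras of the sizes of the blocks, which add up to N (lemma
    frame_full).

    If conversely A is full, the diagonal matrix units of the direct sum pull back to N
    orthogonal idempotents of A (x) F, and clearing denominators gives N pairwise
    orthogonal elements of A with nonzero squares (lemma full_orthogonal_family).
    These need not be symmetric, but they are diagonal in a common basis, and a
    division-free Gram-Schmidt process turns them into symmetric ones (lemma
    gram_schmidt).  The frame of the latter gives the required
    family: the sum s of the x_ii is central, the elements x_ii (adj x_ii) are symmetric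
    and orthogonal, and their sum is s (adj s) (lemma orthogonal_symmetric_central). *)

Set Implicit Arguments.
Unset Strict Implicit.
Unset Printing Implicit Defensive.

Import Order.TTheory GRing.Theory Num.Theory.
Import numFieldNormedType.Exports.

Local Open Scope ring_scope.

(** * Localizations and tensor products with fractions *)

Section Localization.
Variables (Z : comPzRingType) (S : mulrClosed Z).

Definition frac (a s : Z) (sS : s \in S) : loc S := (\pi_(loc S) (mkfrac a sS))%qT.

Lemma fracP (p : loc S) : exists a s (sS : s \in S), p = frac a sS.
Proof.
elim/quotW: p => -[a [s sS]]; exists a, s, sS; congr (\pi_(loc S) _)%qT.
Qed.

Lemma frac_eq a b s t (sS : s \in S) (tS : t \in S) :
  a * t = b * s -> frac a sS = frac b tS.
Proof. by move=> e; apply: (loc_eq (u := 1)); rewrite ?rpred1 // e subrr mulr0. Qed.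

Lemma frac_eqP a b s t (sS : s \in S) (tS : t \in S) :
  frac a sS = frac b tS -> exists2 u, u \in S & u * (a * t - b * s) = 0.
Proof. by move=> /eqmodP/asboolP. Qed.

Lemma loc_ofE a : loc_of S a = frac a (rpred1 S).
Proof. by []. Qed.

Lemma fracD a b s t (sS : s \in S) (tS : t \in S) :
  frac a sS + frac b tS = frac (a * t + b * s) (rpredM sS tS).
Proof.
rewrite [LHS](loc_addE (mkfrac a sS) (mkfrac b tS)).
by apply: (loc_eq (u := 1)); rewrite ?rpred1 // !(faddE, fmulE, foppE) /fnum /fden /=; ring.
Qed.

Lemma fracM a b s t (sS : s \in S) (tS : t \in S) :
  frac a sS * frac b tS = frac (a * b) (rpredM sS tS).
Proof.
rewrite [LHS](loc_mulE (mkfrac a sS) (mkfrac b tS)).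
by apply: (loc_eq (u := 1)); rewrite ?rpred1 // !(faddE, fmulE, foppE) /fnum /fden /=; ring.
Qed.

Lemma fracN a s (sS : s \in S) : - frac a sS = frac (- a) sS.
Proof.
rewrite [LHS](loc_oppE (mkfrac a sS)).
by apply: (loc_eq (u := 1)); rewrite ?rpred1 // !(faddE, fmulE, foppE) /fnum /fden /=; ring.
Qed.

Variables (K : fieldType) (chi : {rmorphism Z -> K}).

Lemma loc_lift : (forall s, s \in S -> chi s != 0) ->
  exists f : {rmorphism loc S -> K},
    forall a s (sS : s \in S), f (frac a sS) = chi a / chi s.
Proof.
move=> chiS; pose f (p : loc S) := chi (fnum (repr p)) / chi (fden (repr p)).
have fE a s (sS : s \in S) : f (frac a sS) = chi a / chi s.
  rewrite /f; have := loc_reprP (mkfrac a sS); rewrite -/(frac a sS).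
  case: (repr (frac a sS)) => b [t tS] [u uS]; rewrite /fnum /fden /= => e.
  apply/eqP; rewrite eqr_div ?chiS // eq_sym -subr_eq0.
  move/(congr1 chi)/eqP: e; rewrite rmorphM rmorph0 mulf_eq0 (negPf (chiS _ uS)) /=.
  by rewrite rmorphB !rmorphM.
have f_zmod : zmod_morphism f.
  move=> p q; have [a [s [sS ->]]] := fracP p; have [b [t [tS ->]]] := fracP q.
  rewrite fracN fracD !fE !rmorphD !rmorphM rmorphN.
  by field; rewrite !chiS.
have f_monoid : GRing.monoid_morphism f.
  split=> [|p q]; first by rewrite (_ : 1 = frac 1 (rpred1 S)) // fE divff ?chiS ?rpred1.
  have [a [s [sS ->]]] := fracP p; have [b [t [tS ->]]] := fracP q.
  by rewrite fracM !fE !rmorphM; field; rewrite !chiS.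
pose fA := GRing.isZmodMorphism.Build _ _ f f_zmod.
pose fM := GRing.isMonoidMorphism.Build _ _ f f_monoid.
pose F : {rmorphism loc S -> K} := HB.pack f fA fM.
by exists F => a s sS; exact: fE.
Qed.

End Localization.

Section Tensor.
Variables (A : nzRingType) (B : comPzRingType) (iota : {rmorphism center A -> B}).

Lemma pure_tensorDl a a' b :
  pure_tensor iota (a + a') b = pure_tensor iota a b + pure_tensor iota a' b.
Proof.
rewrite [RHS](tensor_addE iota [:: (a, b)] [:: (a', b)]).
exact/tens_eq/tens_addl.
Qed.

Lemma pure_tensorM a a' b b' :
  pure_tensor iota a b * pure_tensor iota a' b' = pure_tensor iota (a * a') (b * b').
Proof. exact: (tensor_mulE iota [:: (a, b)] [:: (a', b')]). Qed.

Lemma pure_tensor_balanced a (z : center A) b :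
  pure_tensor iota (a * val z) b = pure_tensor iota a (iota z * b).
Proof. exact/tens_eq/tens_balanced. Qed.

Lemma pure_tensor0 b : pure_tensor iota 0 b = 0.
Proof. exact/tens_eq/tens_zero. Qed.

Lemma tensor_ind (Q : tensor iota -> Prop) : Q 0 ->
  (forall a b t, Q t -> Q (pure_tensor iota a b + t)) -> forall t, Q t.
Proof.
move=> Q0 QD; elim/quotW; elim=> [|[a b] s IHs] //.
by have := QD a b _ IHs; rewrite [X in Q X -> _](tensor_addE iota [:: (a, b)] s).
Qed.

(** The sum of the products of the two factors respects each generator of the tensor
    congruence; commutation of the two images is what makes it multiplicative. *)
Lemma tensor_lift (E : pzRingType) (f : {rmorphism A -> E}) (g : {rmorphism B -> E}) :
    (forall a b, f a * g b = g b * f a) ->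
    (forall z : center A, f (val z) = g (iota z)) ->
  exists F : {rmorphism tensor iota -> E},
    forall a b, F (pure_tensor iota a b) = f a * g b.
Proof.
move=> fgC fgz; pose sf (s : seq (A * B)) := \sum_(x <- s) f x.1 * g x.2.
pose F (t : tensor iota) := sf (repr t).
have sf_cong s t : tens_cong iota s t -> sf s = sf t.
  elim=> {s t} //=.
  - by move=> s t u _ -> _ ->.
  - by move=> s s' t t' _ e _ e'; rewrite /sf !big_cat /= -!/(sf _) e e'.
  - by move=> s t; rewrite /sf !big_cat /= addrC.
  - by move=> b; rewrite /sf big_seq1 big_nil rmorph0 mul0r.
  - by move=> a a' b; rewrite /sf big_seq1 big_cons big_seq1 /= rmorphD mulrDl.
  - by move=> a b b'; rewrite /sf big_seq1 big_cons big_seq1 /= rmorphD mulrDr.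
  - by move=> a z b; rewrite /sf !big_seq1 /= !rmorphM /= -fgz mulrA.
have FE s : F (\pi_(tensor iota) s)%qT = sf s by apply/sf_cong/tens_reprP.
have F_nmod : nmod_morphism F.
  split=> [|]; first by rewrite [LHS]FE /sf big_nil.
  elim/quotW=> s; elim/quotW=> t.
  by rewrite [X in F X](tensor_addE iota s t) !FE /sf big_cat.
have F_monoid : GRing.monoid_morphism F.
  split=> [|]; first by rewrite [LHS]FE /sf big_seq1 !rmorph1 mulr1.
  elim/quotW=> s; elim/quotW=> t.
  rewrite [X in F X](tensor_mulE iota s t) !FE /sf big_allpairs_dep /= mulr_suml.
  apply: eq_bigr => x _; rewrite mulr_sumr; apply: eq_bigr => y _.
  by rewrite !rmorphM -!mulrA (mulrA (f y.1)) fgC !mulrA.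
pose FA := GRing.isNmodMorphism.Build _ _ F F_nmod.
pose FM := GRing.isMonoidMorphism.Build _ _ F F_monoid.
pose G : {rmorphism tensor iota -> E} := HB.pack F FA FM.
by exists G => a b; rewrite [LHS]FE /sf big_seq1.
Qed.

End Tensor.

Section CentralFractions.
Variable A : nzRingType.
Local Notation Z := (center A).
Local Notation S := (GRing.MulClosed.clone Z (@regular Z) _).
Local Notation T := (tensor_totfrac A).
Local Notation pt := (pure_tensor (totfrac_of Z)).

Lemma pure_tensor_frac a (z s : Z) (sS : s \in S) :
  pt a (frac z sS) = pt (a * val z) (frac 1 sS).
Proof.
rewrite pure_tensor_balanced /= loc_ofE fracM.
congr (pure_tensor _ _ _); apply: frac_eq; ring.
Qed.

Lemma pure_tensor_cancel a (u s : Z) (uS : u \in S) (sS : s \in S) :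
  pt (a * val u) (frac 1 (rpredM uS sS)) = pt a (frac 1 sS).
Proof.
rewrite pure_tensor_balanced /= loc_ofE fracM.
congr (pure_tensor _ _ _); apply: frac_eq; ring.
Qed.

(** Finitely many fractions have a common denominator, and central numerators move
    across the tensor sign. *)
Lemma tensor_pure (t : T) : exists a (s : Z) (sS : s \in S), t = pt a (frac 1 sS).
Proof.
elim/tensor_ind: t => [|a b t [a' [s' [sS' ->]]]].
  by exists 0, 1, (rpred1 S); rewrite pure_tensor0.
have [z [s [sS ->]]] := fracP b; rewrite (pure_tensor_frac a z sS).
exists (a * val z * val s' + a' * val s), (s' * s), (rpredM sS' sS).
rewrite pure_tensorDl (pure_tensor_cancel (a * val z)); congr (_ + _).
rewrite -(pure_tensor_cancel _ sS sS'); congr (pure_tensor _ _ _).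
by apply: frac_eq; ring.
Qed.

(** An alias of A, so that the scaling notation and its lemmas are available for
    the action of the center. *)
Definition over_center : Type := A.
HB.instance Definition _ := GRing.Zmodule.on over_center.

Definition center_scale (z : Z) (a : over_center) : over_center := val z * (a : A).

Fact center_scaleA z z' a : center_scale z (center_scale z' a) = center_scale (z * z') a.
Proof. by rewrite /center_scale /= mulrA. Qed.
Fact center_scale1 : left_id 1 center_scale.
Proof. by move=> a; rewrite /center_scale /= mul1r. Qed.
Fact center_scaleDr : right_distributive center_scale +%R.
Proof. by move=> z a b; rewrite /center_scale mulrDr. Qed.
Fact center_scaleDl a : {morph center_scale^~ a : z z' / z + z'}.
Proof. by move=> z z'; rewrite /center_scale /= mulrDl. Qed.

HB.instance Definition _ := GRing.Zmodule_isLmodule.Build Z over_center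
  center_scaleA center_scale1 center_scaleDr center_scaleDl.

(** The pair (a, s) stands for the fraction a / s, with a in A and s central and
    regular; frac_eqv is the equality of such fractions. *)
Definition frac_eqv (p q : over_center * Z) : Prop :=
  exists2 u : Z, u \in S & (u * q.2) *: p.1 = (u * p.2) *: q.1.

Definition frac_add (p q : over_center * Z) : over_center * Z :=
  (q.2 *: p.1 + p.2 *: q.1, p.2 * q.2).

Lemma scaler_multiple (k p q c d : Z) (x y : over_center) :
  p *: x = q *: y -> c = k * p -> d = k * q -> c *: x = d *: y.
Proof. by move=> e -> ->; rewrite -!scalerA e. Qed.

Lemma frac_eqv_trans p q r : q.2 \in S ->
  frac_eqv p q -> frac_eqv q r -> frac_eqv p r.
Proof.
move=> qS [u uS epq] [v vS eqr]; exists (u * v * q.2); first by rewrite !rpredM.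
rewrite (scaler_multiple (k := v * r.2) epq (d := v * r.2 * (u * p.2))) //; last by ring.
by apply: (scaler_multiple (k := u * p.2) eqr); ring.
Qed.

Lemma frac_eqv_add p p' q q' :
  frac_eqv p p' -> frac_eqv q q' -> frac_eqv (frac_add p q) (frac_add p' q').
Proof.
move=> [u uS ep] [v vS eq]; exists (u * v); first by rewrite rpredM.
rewrite /= !scalerDr !scalerA; congr (_ + _).
  by apply: (scaler_multiple (k := v * q.2 * q'.2) ep); ring.
by apply: (scaler_multiple (k := u * p.2 * p'.2) eq); ring.
Qed.

(** The fraction that the formal sum s of tensors a (x) z / d represents, namely the
    sum of the a z / d, with the product of the denominators as denominator. *)
Definition tensor_frac (s : seq (A * totfrac Z)) : over_center * Z :=
  foldr (fun x p => frac_add (fnum (repr x.2) *: (x.1 : over_center), fden (repr x.2)) p)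
    (0, 1) s.

Lemma tensor_frac_den s : (tensor_frac s).2 \in S.
Proof. by elim: s => [|x s IHs] /=; rewrite ?rpred1 // rpredM ?fdenP. Qed.

Lemma tensor_frac_cat s t :
  tensor_frac (s ++ t) = frac_add (tensor_frac s) (tensor_frac t).
Proof.
elim: s => [|x s IHs] /=.
  by rewrite /frac_add scaler0 add0r scale1r mul1r; case: (tensor_frac t).
rewrite IHs /frac_add /= !scalerDr !scalerA addrA !mulrA.
by congr (_ *: _ + _ *: _ + _, _); ring.
Qed.

Lemma frac_reprP (b : totfrac Z) (z s : Z) (sS : s \in S) : b = frac z sS ->
  exists2 u, u \in S & u * (fnum (repr b) * s) = u * (z * fden (repr b)).
Proof.
move=> eb; have : frac (fnum (repr b)) (fdenP (repr b)) = frac z sS.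
  rewrite -eb -[RHS]reprK; case: (repr b) => x [d dS] /=.
  exact: frac_eq.
by move/frac_eqP => [u uS /eqP]; rewrite mulrBr subr_eq0 => /eqP e; exists u.
Qed.

Lemma fracE (b : totfrac Z) : b = frac (fnum (repr b)) (fdenP (repr b)).
Proof. by rewrite -{1}[b]reprK; case: (repr b) => x [d dS]; exact: frac_eq. Qed.

Lemma tensor_frac_cong s t : tens_cong (totfrac_of Z) s t ->
  frac_eqv (tensor_frac s) (tensor_frac t).
Proof.
have S1 : 1 \in S := rpred1 S.
elim=> {s t}.
- by move=> s; exists 1.
- by move=> s t _ [u uS e]; exists u.
- by move=> s t u _ st _; exact: (frac_eqv_trans (tensor_frac_den t)).
- by move=> s s' t t' _ ss _ tt; rewrite !tensor_frac_cat; exact: frac_eqv_add.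
- move=> s t; rewrite !tensor_frac_cat; exists 1 => //.
  by rewrite /= addrC (mulrC (tensor_frac t).2).
- by move=> b; exists 1; rewrite //= !scaler0 !addr0 !scaler0.
- move=> a a' b; exists 1 => //=.
  rewrite !scaler0 !addr0 !scalerDr !scalerA; congr (_ *: _ + _ *: _); ring.
- move=> a b b'.
  have eb : b + b' = frac (fnum (repr b) * fden (repr b') + fnum (repr b') * fden (repr b))
      (rpredM (fdenP (repr b)) (fdenP (repr b'))).
    by rewrite {1}(fracE b) {1}(fracE b') fracD.
  have [u uS e] := frac_reprP eb.
  exists u => //=; rewrite !scaler0 !addr0 !scalerDr !scalerA -scalerDl.
  by congr (_ *: _); ring: e.
- move=> a z b.
  have eb : totfrac_of Z z * b = frac (z * fnum (repr b)) (rpredM (rpred1 S) (fdenP (repr b))).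
    by rewrite {1}(fracE b) [totfrac_of Z z]loc_ofE fracM.
  have [u uS e] := frac_reprP eb.
  exists u => //=; rewrite !scaler0 !addr0.
  rewrite -(centerP z a) [val z * a]/(z *: (a : over_center)) !scalerA.
  by congr (_ *: _); ring: e.
Qed.

(** Flatness of localization: a (x) 1/s only vanishes when the fraction a / s does. *)
Lemma tensor_torsion a (s : Z) (sS : s \in S) :
  pt a (frac 1 sS) = 0 -> exists2 u : Z, u \in S & a * val u = 0.
Proof.
move/eqmodP/asboolP/tensor_frac_cong => [u uS /=].
rewrite !scaler0 addr0 scalerA => e.
have [v vS ev] := frac_reprP (erefl (frac 1 sS)).
exists (v * fden (repr (frac 1 sS)) * u); first by rewrite !rpredM ?fdenP.
rewrite -centerP; apply: (etrans _ (scaler0 over_center (v * s))); rewrite -e.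
by rewrite !scalerA -[LHS]/(_ *: (a : over_center)); congr (_ *: _); ring: ev.
Qed.

End CentralFractions.

(** * Orthogonal families, Gram-Schmidt and matrix frames *)

Section OrthogonalFamilies.
Variables (K : fieldType) (N : nat) (B : 'I_N -> 'M[K]_N).

(** Choose rows w_i with w_i B_i B_i <> 0.  Orthogonality makes the rows w_i B_i
    independent, since multiplying a relation by B_j isolates one coefficient; in the
    basis that they form, B_j has a single nonzero row, supported on the diagonal. *)
Lemma orthogonal_family_diag :
    (forall i j, i != j -> B i *m B j = 0) -> (forall i, B i *m B i != 0) ->
  exists (g : 'M[K]_N) (l : 'I_N -> K), g \in unitmx /\
    forall i, l i != 0 /\ g *m B i = l i *: delta_mx i i *m g.
Proof.
move=> B_orth B_sq.
have /fin_all_exists[w w_neq0] i : exists w : 'rV[K]_N, w *m (B i *m B i) != 0.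
  have /rowV0Pn[_ /submxP[w ->] w0] : B i *m B i != 0 := B_sq i.
  by exists w.
pose g := \matrix_i (w i *m B i).
have gB (v : 'rV[K]_N) j : v *m g *m B j = v 0 j *: (w j *m (B j *m B j)).
  rewrite (mulmx_sum_row v g) mulmx_suml (bigD1 j) //= big1 ?addr0 => [|i ij].
    by rewrite rowK -scalemxAl mulmxA.
  by rewrite rowK -scalemxAl -mulmxA B_orth // mulmx0 scaler0.
have g_unit : g \in unitmx.
  rewrite -row_free_unit; apply: inj_row_free => v vg0.
  apply/rowP => j; rewrite mxE; apply/eqP; move: (gB v j); rewrite vg0 mul0mx.
  by move/esym/eqP; rewrite scaler_eq0 (negPf (w_neq0 j)) orbF.
have [v vE] : exists v : 'I_N -> 'rV[K]_N, forall j, w j *m (B j *m B j) = v j *m g.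
  by exists (fun j => w j *m (B j *m B j) *m invmx g) => j; rewrite mulmxKV.
have v0 j k : k != j -> v j 0 k = 0.
  move=> kj; apply/eqP; move: (gB (v j) k); rewrite -vE -!mulmxA.
  have -> : B j *m B k = 0 by apply: B_orth; rewrite eq_sym.
  rewrite !mulmx0.
  by move/esym/eqP; rewrite scaler_eq0 (negPf (w_neq0 k)) orbF.
have vd j : v j = v j 0 j *: delta_mx 0 j.
  apply/rowP => k; rewrite !mxE eqxx /=; case: eqP => [->|/eqP kj]; first by rewrite mulr1.
  by rewrite v0 // mulr0.
exists g, (fun j => v j 0 j); split=> // j; split.
  by apply: contraNneq (w_neq0 j) => vj0; rewrite vE vd vj0 scale0r mul0mx.
apply/row_matrixP => i; rewrite row_mul -scalemxAl -[row i (_ *: _)]/(row i _).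
rewrite linearZ /= row_mul rowK rowE mul_delta_mx_cond.
have [->|ij] := eqVneq i j; first by rewrite -mulmxA vE [in LHS]vd mulr1n scalemxAl.
by rewrite mulr0n mul0mx scaler0 -mulmxA B_orth // mulmx0.
Qed.

End OrthogonalFamilies.

Section DeltaMatrices.
Variables (K : pzRingType) (N : nat).

Lemma mulmx_deltar (M : 'M[K]_N) (j k i m : 'I_N) : (M *m delta_mx j k) i m = M i j *+ (m == k).
Proof.
rewrite mxE (bigD1 j) //= big1 => [|s sj]; last by rewrite mxE (negPf sj) mulr0.
by rewrite mxE eqxx addr0 /= mulr_natr.
Qed.

Lemma mulmx_deltal (M : 'M[K]_N) (j k i m : 'I_N) : (delta_mx j k *m M) i m = M k m *+ (i == j).
Proof.
rewrite mxE (bigD1 k) //= big1 => [|s sj]; last by rewrite mxE (negPf sj) andbF mul0r.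
by rewrite mxE eqxx addr0 andbT mulr_natl.
Qed.

End DeltaMatrices.

Lemma conjugate_representation (A : nzRingType) (K : fieldType) (N : nat)
    (rho : {rmorphism A -> 'M[K]_N}) (g : 'M[K]_N) : injective rho -> g \in unitmx ->
  exists rho' : {rmorphism A -> 'M[K]_N},
    injective rho' /\ forall a, rho' a = g *m rho a *m invmx g.
Proof.
move=> rho_inj gU; pose f a := g *m rho a *m invmx g.
have fB : zmod_morphism f by move=> a b; rewrite /f rmorphB mulmxBr mulmxBl.
have fM : GRing.monoid_morphism f.
  split=> [|a b]; first by rewrite /f rmorph1 mulmx1 mulmxV.
  by rewrite /f rmorphM -[RHS]/(_ *m _) !mulmxA mulmxKV.
pose fA' := GRing.isZmodMorphism.Build _ _ f fB.
pose fM' := GRing.isMonoidMorphism.Build _ _ f fM.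
pose F : {rmorphism A -> 'M[K]_N} := HB.pack f fA' fM'.
exists F; split=> // a b /(congr1 (fun M => invmx g *m M *m g)).
by rewrite /= /f !mulmxA !mulVmx // !mul1mx !mulmxKV // => /rho_inj.
Qed.

Section Involution.
Variables (A : nzRingType) (adj : A -> A).
Hypotheses (adjD : {morph adj : a b / a + b}) (adjM : forall a b, adj (a * b) = adj b * adj a)
  (adjK : involutive adj) (adj_def : forall a, a * adj a = 0 -> a = 0).

Lemma adj0 : adj 0 = 0.
Proof. by apply: (addrI (adj 0)); rewrite -adjD !addr0. Qed.

Lemma adj_eq0 a : (adj a == 0) = (a == 0).
Proof. by rewrite -(inj_eq (inv_inj adjK)) adjK adj0. Qed.

Lemma adj_def' a : adj a * a = 0 -> a = 0.
Proof.
by move=> a0; apply/eqP; rewrite -adj_eq0; apply/eqP/adj_def; rewrite adjK.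
Qed.

Lemma symmetric_square_neq0 a : adj a = a -> a != 0 -> a * a != 0.
Proof. by move=> sa; apply: contra_neq => a0; apply: adj_def; rewrite sa. Qed.

Definition orthogonal_symmetric (N : nat) (V : 'I_N -> A) : Prop :=
  [/\ forall i, adj (V i) = V i, forall i, V i != 0
    & forall i j, i != j -> V i * V j = 0].

Section Representation.
Variables (K : fieldType) (N : nat) (rho : {rmorphism A -> 'M[K]_N}).
Hypothesis rho_inj : injective rho.

Lemma rho_eq0 a : (rho a == 0) = (a == 0).
Proof. by rewrite -(rmorph0 rho) (inj_eq rho_inj). Qed.

Lemma diagonal_representation (b : 'I_N -> A) :
    (forall i j, i != j -> b i * b j = 0) -> (forall i, b i * b i != 0) ->
  exists (rho' : {rmorphism A -> 'M[K]_N}) (l : 'I_N -> K), injective rho' /\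
    forall i, l i != 0 /\ rho' (b i) = l i *: delta_mx i i.
Proof.
move=> b_orth b_sq; have [||g [l [gU gl]]] := @orthogonal_family_diag K N (rho \o b).
- by move=> i j ij; rewrite /= -[LHS]rmorphM b_orth // rmorph0.
- by move=> i; rewrite /= -[X in X != _]rmorphM rho_eq0.
have [rho' [rho'_inj rho'E]] := conjugate_representation rho_inj gU.
exists rho', l; split=> // i; have [li e] := gl i; split=> //.
by rewrite rho'E e mulmxK.
Qed.

Section GramSchmidt.

(** A rank-one matrix whose column space lies in the span of the first k + 1 basis
    vectors.  This triangularity keeps the successive columns of the Gram-Schmidt
    process independent. *)
Definition upper_rank1 (k : nat) (v : A) : Prop :=
  exists (c : 'cV[K]_N) (r : 'rV[K]_N),
    rho v = c *m r /\ forall j : 'I_N, (k < j)%N -> c j 0 = 0.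

(** For v = c r of rank one, v a v = c (r a c) r, and r a c is a scalar. *)
Lemma rank1_sandwich v (c : 'cV[K]_N) (r : 'rV[K]_N) a : rho v = c *m r ->
  rho (v * a * v) = (r *m rho a *m c) 0 0 *: rho v.
Proof.
move=> e; rewrite !rmorphM -!mulmxE e !mulmxA -(mulmxA c) -(mulmxA c).
by rewrite [X in c *m X](mx11_scalar (r *m rho a *m c)) mul_mx_scalar scalemxAl.
Qed.

Lemma upper_rank1_comm k v a : upper_rank1 k v -> v * a * v * v = v * v * a * v.
Proof.
move=> [c [r [e _]]]; have -> : v * v * a * v = v * (v * a * v) by rewrite !mulrA.
apply: rho_inj; rewrite [LHS]rmorphM [RHS]rmorphM !(rank1_sandwich a e) -!mulmxE.
by rewrite -scalemxAl -scalemxAr.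
Qed.

Definition upper_column (k : 'I_N) (a : A) : Prop :=
  exists c : 'cV[K]_N, [/\ rho a = c *m delta_mx 0 k, c k 0 != 0
    & forall j : 'I_N, (k < j)%N -> c j 0 = 0].

Lemma upper_column_neq0 k a : upper_column k a -> a != 0.
Proof.
move=> [c [e ck _]]; rewrite -rho_eq0 e; apply: contraNneq ck => /matrixP/(_ k k).
by rewrite !mxE big_ord1 mxE !eqxx mulr1 => ->.
Qed.

(** One projection step of Gram-Schmidt, with denominators cleared inside A.  The
    elements v x v are scalar multiples of v, so they commute with v, and

      a' = (a (adj a) v v v) a - (v v a (adj a) v) a

    satisfies v a' = 0.  Unless v a = 0 from the start, the first term is a nonzero
    scalar multiple of a by positivity, while the columns of the second lie in the
    column space of v, whose vectors have zero k-th entry. *)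
Lemma project_away (k : 'I_N) l a v : adj v = v -> v != 0 -> upper_rank1 l v ->
    (l < k)%N -> upper_column k a ->
  exists2 a', upper_column k a' &
    v * a' = 0 /\ forall w, w * v = 0 -> w * a = 0 -> w * a' = 0.
Proof.
move=> sv v0 rv lk ua; have [va|va] := eqVneq (v * a) 0; first by exists a.
exists (a * adj a * v * v * v * a - v * v * a * adj a * v * a); last first.
  split=> [|w wv wa]; last by rewrite mulrBr !mulrA wa wv !mul0r subrr.
  rewrite mulrBr !mulrA; have vC := fun x => upper_rank1_comm x rv.
  have := vC (a * adj a); rewrite !mulrA => ->.
  by have := vC (v * a * adj a); rewrite !mulrA => ->; rewrite subrr.
have [c [ea ck cj]] := ua; have [g [r [ev gj]]] := rv.
have [m vv] : exists m, rho (v * v) = m *: rho v.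
  by exists ((r *m rho 1 *m g) 0 0); rewrite -(rank1_sandwich 1 ev) mulr1.
pose z := ((delta_mx 0 k : 'rV[K]_N) *m rho (adj a * v * v * v) *m c) 0 0.
have ez : rho (a * adj a * v * v * v * a) = z *: rho a.
  by rewrite -(rank1_sandwich (adj a * v * v * v) ea) !mulrA.
exists (z *: c - g *m (r *m rho (v * a * adj a * v) *m c)); split.
- rewrite rmorphB /= ez ea mulmxBl -scalemxAl; congr (_ - _).
  rewrite (_ : v * v * a * adj a * v * a = v * (v * a * adj a * v * a)).
    by rewrite (rmorphM rho v) (rmorphM rho (v * a * adj a * v)) -!mulmxE ev ea !mulmxA.
  by rewrite !mulrA.
- rewrite !mxE big_ord1 gj // mul0r subr0 mulf_neq0 //.
  apply: contraNneq va => z0; move: ez; rewrite z0 scale0r.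
  (* The symmetric element q is (adj (v a)) (v a), and a q = 0 forces q q = 0. *)
  have q0 : a * (adj a * v * v * a) = 0 -> v * a = 0.
    set q := adj a * v * v * a => aq.
    have sq : adj q = q by rewrite !adjM adjK sv !mulrA.
    apply: adj_def'; rewrite adjM sv -[RHS](_ : q = 0) ?mulrA //.
    by apply: adj_def; rewrite sq {1}/q -mulrA aq mulr0.
  have m0 : m != 0.
    apply: contra_neq (symmetric_square_neq0 sv v0) => m0.
    by apply: rho_inj; rewrite vv m0 scale0r rmorph0.
  rewrite (_ : a * adj a * v * v * v * a = a * adj a * (v * v * (v * a))).
    rewrite (rmorphM rho (a * adj a)) (rmorphM rho (v * v)) vv -!mulmxE.
    rewrite -scalemxAl -scalemxAr !mulmxE -!rmorphM => /eqP.
    rewrite scaler_eq0 (negPf m0) rho_eq0 => /eqP q1.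
    by apply/eqP/q0; rewrite -q1 !mulrA.
  by rewrite !mulrA.
- by move=> j kj; rewrite !mxE big_ord1 cj // gj ?mul0r ?mulr0 ?subrr // (ltn_trans lk).
Qed.

(** Making b_k successively orthogonal to V_0, ..., V_(k-1) gives an element a with
    V_i a = 0 and a nonzero k-th entry, and V_k = a (adj a) is then symmetric,
    orthogonal to the previous ones and again of rank one with the columns of a. *)
Lemma gram_schmidt (b : 'I_N -> A) (l : 'I_N -> K) :
    (forall i, l i != 0 /\ rho (b i) = l i *: delta_mx i i) ->
  exists V : 'I_N -> A, orthogonal_symmetric V.
Proof.
move=> bl.
have /(_ N (leqnn N)) : forall k, (k <= N)%N -> exists V : nat -> A,
    (forall i, (i < k)%N -> [/\ adj (V i) = V i, V i != 0 & upper_rank1 i (V i)]) /\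
    (forall i j, (i < k)%N -> (j < k)%N -> i != j -> V i * V j = 0).
  elim=> [|k IHk] kN; first by exists (fun=> 0).
  have [V [sV oV]] := IHk (ltnW kN); pose k' := Ordinal kN.
  have [a ua Va] : exists2 a, upper_column k' a & forall i, (i < k)%N -> V i * a = 0.
    have /(_ k (leqnn k)) : forall m, (m <= k)%N -> exists2 a,
        upper_column k' a & forall i, (i < m)%N -> V i * a = 0; last by [].
    elim=> [|m IHm] mk.
      exists (b k') => //; have [lk ek] := bl k'.
      exists (l k' *: delta_mx k' 0); split.
      - by rewrite ek -scalemxAl mul_delta_mx.
      - by rewrite !mxE !eqxx mulr1.
      by move=> j kj; rewrite !mxE -(inj_eq val_inj) /= gtn_eqF // mulr0.
    have [a ua Va] := IHm (ltnW mk); have [sm m0 um] := sV m mk.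
    have [a' ua' [ma' wa']] := project_away (k := k') sm m0 um mk ua.
    exists a' => // i; rewrite ltnS leq_eqVlt => /orP[/eqP-> //|im].
    by apply: wa' (Va i im); apply: oV; rewrite ?(ltn_trans im) ?ltn_eqF.
  exists (fun i => if i == k then a * adj a else V i); split=> [i|i j].
    rewrite ltnS leq_eqVlt; case: eqP => [-> _|_ /= /sV //]; split.
    - by rewrite adjM adjK.
    - by apply: contraNneq (upper_column_neq0 ua) => /adj_def ->.
    have [c [ea _ cj]] := ua; exists c, (delta_mx 0 k' *m rho (adj a)).
    by rewrite rmorphM -mulmxE ea mulmxA.
  have lt m : (m < k.+1)%N -> m <> k -> (m < k)%N.
    by rewrite ltnS leq_eqVlt => /orP[/eqP|].
  case: (i =P k) => [->|ik]; case: (j =P k) => [->|jk] ltik ltjk.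
  - by rewrite eqxx.
  - move=> _; apply: (inv_inj adjK); have [sj _ _] := sV j (lt _ ltjk jk).
    by rewrite !adjM adjK sj mulrA Va ?lt // mul0r adj0.
  - by move=> _; rewrite mulrA Va ?lt // mul0r.
  by apply: oV; exact: lt.
move=> [V [sV oV]]; exists (fun i => V i); split=> [i|i|i j ij].
- by have [] := sV i (ltn_ord i).
- by have [] := sV i (ltn_ord i).
exact: oV.
Qed.

End GramSchmidt.

(** Two indices lie in the same block when they have the same root.  The elements
    x i j of A represent matrix units up to the factors u i, which cannot be
    normalized to 1 without denominators. *)
Definition matrix_frame (theta : {rmorphism A -> 'M[K]_N}) (root : 'I_N -> 'I_N)
    (u : 'I_N -> K) (x : 'I_N -> 'I_N -> A) : Prop :=
  [/\ injective theta,
      forall i, root (root i) = root i,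
      forall a i j, root i != root j -> theta a i j = 0,
      forall i, u i != 0 /\ u (root i) = u i
    & forall i j, root i = root j -> theta (x i j) = u i *: delta_mx i j].

Lemma delta_sandwich (M : 'M[K]_N) i j :
  delta_mx i i *m M *m delta_mx j j = M i j *: delta_mx i j.
Proof.
apply/matrixP => k m; rewrite !mxE (bigD1 j) //= big1 => [|s sj]; last first.
  by rewrite !mxE (negPf sj) mulr0.
rewrite !mxE (bigD1 i) //= big1 => [|s si]; last by rewrite !mxE (negPf si) andbF mul0r.
by rewrite !mxE !eqxx andbT /= !addr0; case: (k == i); rewrite /= ?mul1r ?mul0r ?mulr0.
Qed.

(** Connected indices, those with V_i A V_j <> 0, form the blocks.  Choosing nonzero
    p_i in V_r A V_i and q_i in V_i A V_r, where r is the root of i, q_i p_j represents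
    a multiple of E_ij.  Multiplying q_i by the p_k q_k of the other indices k of the
    block makes p_i q_i independent of i, and conjugating by the diagonal matrix of
    the scalars of the p_i makes the multiple independent of j. *)
Lemma frame_exists (V : 'I_N -> A) : orthogonal_symmetric V ->
  exists theta root u x, matrix_frame theta root u x /\
    forall i, exists y, x i i = V i * y * V i.
Proof.
move=> [Vs V0 Vo].
have [||rho' [l [rho'_inj lV]]] := @diagonal_representation V.
- exact: Vo.
- by move=> i; apply: symmetric_square_neq0.
have l0 i : l i != 0 by have [] := lV i.
have VaV i j a : rho' (V i * a * V j) = (l i * l j * rho' a i j) *: delta_mx i j.
  rewrite !rmorphM -!mulmxE (lV i).2 (lV j).2 -!scalemxAl -scalemxAr delta_sandwich.
  by rewrite !scalerA.
pose conn i j := `[< exists a, rho' a i j != 0 >].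
have connP i j a : rho' a i j != 0 -> conn i j by move=> aij; apply/asboolP; exists a.
have conn_refl i : conn i i.
  by apply: (connP i i (V i)); rewrite (lV i).2 !mxE !eqxx mulr1.
have conn_trans i j k : conn i j -> conn j k -> conn i k.
  move=> /asboolP[a aij] /asboolP[b bjk]; apply: (connP _ _ (a * V j * b)).
  rewrite !rmorphM -!mulmxE (lV j).2 -scalemxAr -scalemxAl mxE mulf_neq0 //.
  rewrite mxE (bigD1 j) //= big1 => [|s sj].
    by rewrite mulmx_deltar eqxx addr0 mulf_neq0.
  by rewrite mulmx_deltar (negPf sj) mul0r.
have conn_sym i j : conn i j -> conn j i.
  move=> /asboolP[a aij]; apply: (connP _ _ (adj a)).
  have : V i * a * V j != 0.
    rewrite -(inj_eq rho'_inj) rmorph0 VaV; apply: contraNneq aij => /matrixP/(_ i j).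
    by rewrite !mxE !eqxx mulr1 => /eqP; rewrite !mulf_eq0 !(negPf (l0 _)).
  rewrite -adj_eq0 !adjM !Vs mulrA -(inj_eq rho'_inj) rmorph0 VaV.
  by apply: contraNneq => ->; rewrite mulr0 scale0r.
pose root i := odflt i [pick j | conn i j].
have root_conn i : conn i (root i).
  by rewrite /root; case: pickP => //= /(_ i); rewrite conn_refl.
have root_eq i j : conn i j -> root i = root j.
  move=> cij; rewrite /root (eq_pick (Q := conn j)).
    by case: pickP => //= /(_ j); rewrite conn_refl.
  by move=> k; apply/idP/idP; apply: conn_trans => //; apply: conn_sym.
have rootK i : root (root i) = root i by apply/esym/root_eq.
have /fin_all_exists[a aP] i : exists a, rho' a (root i) i != 0.
  by have /conn_sym/asboolP := root_conn i.
have /fin_all_exists[b bP] i : exists b, rho' b i (root i) != 0.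
  by have /asboolP := root_conn i.
pose p i := V (root i) * a i * V i; pose q i := V i * b i * V (root i).
pose pi i := l (root i) * l i * rho' (a i) (root i) i.
pose ka i := l i * l (root i) * rho' (b i) i (root i).
have pi0 i : pi i != 0 by rewrite !mulf_neq0.
have ka0 i : ka i != 0 by rewrite !mulf_neq0.
have pE i : rho' (p i) = pi i *: delta_mx (root i) i by exact: VaV.
have qE i : rho' (q i) = ka i *: delta_mx i (root i) by exact: VaV.
(* The factors p_k q_k represent scalars at the root, whatever their order. *)
pose rest i k := (root k == root i) && (k != i).
pose u i := \prod_(k | root k == root i) (pi k * ka k).
pose x i j := q i * (\prod_(k | rest i k) (p k * q k)) * p j.
have xE i j : root i = root j -> rho' (x i j) = (u i * (pi i)^-1 * pi j) *: delta_mx i j.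
  move=> ij; have -> : rho' (x i j) =
      rho' (q i) *m rho' (\prod_(k | rest i k) (p k * q k)) *m rho' (p j).
    by rewrite !mulmxE -!rmorphM.
  rewrite qE pE -scalemxAl -scalemxAr.
  have -> : delta_mx i (root i) *m rho' (\prod_(k | rest i k) (p k * q k)) =
      (\prod_(k | rest i k) (pi k * ka k)) *: delta_mx i (root i).
    elim/big_rec2: _ => [|k c y /andP[/eqP rk _] IH].
      by rewrite rmorph1 mulmx1 scale1r.
    have -> : rho' (p k * q k * y) = rho' (p k) *m rho' (q k) *m rho' y.
      by rewrite !mulmxE -!rmorphM.
    rewrite pE qE rk -scalemxAl -scalemxAr mul_delta_mx scalerA -scalemxAl -scalemxAr.
    by rewrite mulmxA mul_delta_mx IH scalerA.
  rewrite -!scalemxAl ij mul_delta_mx !scalerA; congr (_ *: _).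
  have -> : u i = pi i * ka i * \prod_(k | rest i k) (pi k * ka k) by rewrite /u (bigD1 i).
  by field; exact: pi0.
pose h : 'M[K]_N := diag_mx (\row_i pi i); pose h' : 'M[K]_N := diag_mx (\row_i (pi i)^-1).
have hh' : h *m h' = 1%:M.
  rewrite mulmx_diag -diag_const_mx; congr diag_mx; apply/rowP => i.
  by rewrite !mxE mulfV.
have [hU _] := mulmx1_unit hh'.
have h'E : invmx h = h' by rewrite -[LHS]mulmx1 -hh' mulKmx.
have [theta [theta_inj thetaE]] := conjugate_representation rho'_inj hU.
have theta_entry c i j : theta c i j = pi i * rho' c i j / pi j.
  by rewrite thetaE h'E mul_diag_mx mul_mx_diag !mxE.
exists theta, root, u, x; split; [split|] => //.
- move=> c i j ij; rewrite theta_entry; apply/eqP; apply: contraNT ij => cij.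
  apply/eqP/root_eq/(connP _ _ c); apply: contraNneq cij => ->.
  by rewrite mulr0 mul0r.
- move=> i; split; last by rewrite /u rootK.
  by apply/prodf_neq0 => k _; rewrite mulf_neq0.
- move=> i j ij; apply/matrixP => m n; rewrite theta_entry xE // !mxE.
  case: eqP => [->|_]; last by rewrite /= !mulr0 mul0r.
  by case: eqP => [->|_]; rewrite /= ?mulr0 ?mul0r // !mulr1; field; rewrite !pi0.
move=> i; exists (b i * V (root i) * (\prod_(k | rest i k) (p k * q k)) * V (root i) * a i).
by rewrite /x /p /q !mulrA.
Qed.

End Representation.
End Involution.

(** * From a matrix frame to the structure of the algebra *)

Section Kernel.
Variables (Z : comNzRingType) (K : fieldType).

(** A predicate on Z indexed by the morphism, so that it carries the structure of a
    prime ideal. *)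
Definition rkernel (chi : {rmorphism Z -> K}) : pred Z := fun z => chi z == 0.

Variable chi : {rmorphism Z -> K}.

Lemma rkernelE z : (z \in rkernel chi) = (chi z == 0).
Proof. by []. Qed.

Fact rkernel_idealr_closed : idealr_closed (rkernel chi).
Proof.
split=> [||a x y]; rewrite !rkernelE ?rmorph0 ?rmorph1 ?oner_eq0 //.
by move=> /eqP x0 /eqP y0; rewrite rmorphD rmorphM x0 y0 mulr0 addr0.
Qed.
Fact rkernel_prime : prime_idealr_closed (rkernel chi).
Proof. by move=> x y; rewrite !rkernelE rmorphM mulf_eq0. Qed.

HB.instance Definition _ := isIdealr.Build Z (rkernel chi) rkernel_idealr_closed.
HB.instance Definition _ := isPrimeIdealrClosed.Build Z (rkernel chi) rkernel_prime.

(** An element w outside the kernel that annihilates it becomes invertible in the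
    localization, so that the kernel becomes zero there and the extension of chi is
    injective. *)
Lemma loc_at_lift : (exists2 w, chi w != 0 & forall z, chi z = 0 -> w * z = 0) ->
  exists2 f : {rmorphism loc_at (rkernel chi) -> K}, injective f
    & forall a s sS, f (@frac _ _ a s sS) = chi a / chi s.
Proof.
move=> [w w0 wz].
have [f fE] := @loc_lift Z (GRing.MulClosed.clone Z (prime_compl (rkernel chi)) _) K chi
  (fun s sS => sS).
exists f => // p q; have [a [s [sS ->]]] := fracP p; have [b [t [tS ->]]] := fracP q.
rewrite !fE => /eqP; rewrite eqr_div // -!rmorphM -subr_eq0 -rmorphB => /eqP/wz e.
by apply: (loc_eq (u := w)).
Qed.

End Kernel.

Section LiftMatrices.
Variables (T : pzRingType) (K L : comPzRingType) (m : nat).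
Variables (F : {rmorphism T -> 'M[K]_m}) (f : {rmorphism L -> K}).

Lemma lift_matrices : injective f -> (forall t i j, exists y, f y = F t i j) ->
  exists G : {rmorphism T -> 'M[L]_m}, forall t, map_mx f (G t) = F t.
Proof.
move=> f_inj /(_ _ _ _)/cid yP; pose G t := \matrix_(i, j) sval (yP t i j).
have GE t : map_mx f (G t) = F t.
  by apply/matrixP => i j; rewrite !mxE (svalP (yP t i j)).
have mf_inj (M M' : 'M[L]_m) : map_mx f M = map_mx f M' -> M = M'.
  by move=> /matrixP e; apply/matrixP => i j; apply: f_inj; have := e i j; rewrite !mxE.
have G_zmod : zmod_morphism G.
  by move=> t t'; apply: mf_inj; rewrite map_mxB !GE rmorphB.
have G_monoid : GRing.monoid_morphism G.
  split=> [|t t']; apply: mf_inj.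
    by rewrite GE rmorph1 [1]/(1%:M) map_scalar_mx rmorph1.
  by rewrite -[X in _ = map_mx f X]/(_ *m _) map_mxM !GE rmorphM.
pose GA := GRing.isZmodMorphism.Build _ _ G G_zmod.
pose GM := GRing.isMonoidMorphism.Build _ _ G G_monoid.
pose G' : {rmorphism T -> 'M[L]_m} := HB.pack G GA GM.
by exists G'.
Qed.

End LiftMatrices.

Section FrameCenter.
Variables (A : nzRingType) (K : fieldType) (N : nat).
Variables (theta : {rmorphism A -> 'M[K]_N}) (root : 'I_N -> 'I_N).
Variables (u : 'I_N -> K) (x : 'I_N -> 'I_N -> A).
Hypothesis frame : matrix_frame theta root u x.
Local Notation Z := (center A).

Let theta_inj : injective theta. Proof. by case: frame. Qed.
Let rootK i : root (root i) = root i. Proof. by case: frame. Qed.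
Let theta0 a i j : root i != root j -> theta a i j = 0.
Proof. by case: frame => _ _ H _ _; exact: H. Qed.
Let u0 i : u i != 0. Proof. by case: frame => _ _ _ /(_ i)[]. Qed.
Let u_root i : u (root i) = u i. Proof. by case: frame => _ _ _ /(_ i)[]. Qed.
Let xE i j : root i = root j -> theta (x i j) = u i *: delta_mx i j.
Proof. by case: frame => _ _ _ _; exact. Qed.

(** Every element of A is block diagonal in the frame, so matrices that are scalar on
    each block commute with A. *)
Lemma frame_central a : (forall i j, i != j -> theta a i j = 0) ->
    (forall i, theta a i i = theta a (root i) (root i)) -> a \in central A.
Proof.
move=> a0 ar; apply/asboolP => b; apply: theta_inj; rewrite !rmorphM -!mulmxE.
apply/matrixP => i j; rewrite !mxE (bigD1 i) //= big1 => [|s si]; last first.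
  by rewrite a0 1?eq_sym // mul0r.
rewrite [RHS](bigD1 j) //= [in RHS]big1 => [|s sj]; last by rewrite (a0 s j) ?mulr0.
rewrite !addr0 mulrC; have [ij|ij] := eqVneq (root i) (root j).
  by rewrite ar ij -ar.
by rewrite theta0 // !mul0r.
Qed.

(** Commutation with the diagonal elements x j j kills the off-diagonal entries. *)
Lemma theta_center (z : Z) i j : i != j -> theta (val z) i j = 0.
Proof.
move=> ij; have : (theta (val z) *m theta (x j j)) i j = (theta (x j j) *m theta (val z)) i j.
  by rewrite !mulmxE -!rmorphM centerP.
rewrite xE // -scalemxAl -scalemxAr [X in X = _ -> _]mxE [X in _ = X -> _]mxE.
rewrite mulmx_deltar mulmx_deltal eqxx (negPf ij) mulr0n mulr0 mulr1n => /eqP.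
by rewrite mulf_eq0 (negPf (u0 j)) => /eqP.
Qed.

(** Commutation with x i (root i) identifies the diagonal entries of a block. *)
Lemma theta_center_root (z : Z) i : theta (val z) i i = theta (val z) (root i) (root i).
Proof.
have : (theta (val z) *m theta (x i (root i))) i (root i) =
    (theta (x i (root i)) *m theta (val z)) i (root i).
  by rewrite !mulmxE -!rmorphM centerP.
rewrite xE ?rootK // -scalemxAl -scalemxAr [X in X = _ -> _]mxE [X in _ = X -> _]mxE.
by rewrite mulmx_deltar mulmx_deltal !eqxx !mulr1n => /mulfI ->.
Qed.

Lemma frame_characters :
  exists chi : 'I_N -> {rmorphism Z -> K}, forall k z, chi k z = theta (val z) k k.
Proof.
suff H k : exists chi : {rmorphism Z -> K}, forall z, chi z = theta (val z) k k.
  exact: (fin_all_exists H).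
pose f (z : Z) := theta (val z) k k.
have fB : zmod_morphism f by move=> z z'; rewrite /f /= rmorphB !mxE.
have fM : GRing.monoid_morphism f.
  split=> [|z z']; first by rewrite /f /= rmorph1 mxE eqxx.
  rewrite /f /= rmorphM -mulmxE mxE (bigD1 k) //= big1 ?addr0 // => j jk.
  by rewrite theta_center 1?eq_sym // mul0r.
pose fA' := GRing.isZmodMorphism.Build _ _ f fB.
pose fM' := GRing.isMonoidMorphism.Build _ _ f fM.
pose F : {rmorphism Z -> K} := HB.pack f fA' fM'.
by exists F.
Qed.

Variable chi : 'I_N -> {rmorphism Z -> K}.
Hypothesis chiE : forall k z, chi k z = theta (val z) k k.

Lemma chi_root k z : chi (root k) z = chi k z.
Proof. by rewrite !chiE -theta_center_root. Qed.

Lemma theta_centerE (z : Z) i j : theta (val z) i j = chi i z *+ (i == j).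
Proof.
by case: eqP => [->|/eqP ij]; rewrite ?chiE // theta_center.
Qed.

Lemma chi_inj z z' : (forall k, chi k z = chi k z') -> z = z'.
Proof.
move=> e; apply/val_inj/theta_inj/matrixP => i j.
by rewrite !theta_centerE e.
Qed.

(** The sum of the x m i a x j m over the block of i and j transports the entry (i, j)
    of a to all diagonal positions of the block, which makes it central. *)
Lemma central_coefficient a i j : root i = root j ->
  exists z : Z, forall m, chi m z = u i ^+ 2 * theta a i j *+ (root m == root i).
Proof.
move=> ij; pose c := \sum_(m | root m == root i) x m i * a * x j m.
have cE : theta c = \sum_(m | root m == root i) (u i ^+ 2 * theta a i j) *: delta_mx m m.
  rewrite rmorph_sum; apply: eq_bigr => m /eqP mi.
  rewrite !rmorphM -!mulmxE !xE ?mi // -!scalemxAl -scalemxAr.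
  rewrite -u_root mi ij u_root scalerA -expr2 -[u i]u_root ij u_root -scalerA; congr (_ *: _).
  apply/matrixP => s t; rewrite mulmx_deltar mulmx_deltal !mxE -mulrnA mulr_natr.
  by rewrite mulnb.
have c_entry s t : theta c s t = u i ^+ 2 * theta a i j *+ ((s == t) && (root s == root i)).
  rewrite cE summxE; have [si|si] := boolP (root s == root i).
    rewrite (bigD1 s) //= big1 => [|m /andP[_ ms]].
      by rewrite !mxE eqxx addr0 andbT eq_sym mulr_natr.
    by rewrite !mxE (eq_sym s) (negPf ms) mulr0.
  rewrite andbF mulr0n big1 // => m mi; rewrite !mxE; case: eqP => [sm|_]; last by rewrite mulr0.
  by rewrite sm mi in si.
have cC : c \in central A.
  apply: frame_central => [s t st|s]; first by rewrite c_entry (negPf st).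
  by rewrite !c_entry !eqxx rootK.
by exists (MkCenter cC) => m; rewrite chiE /= c_entry eqxx.
Qed.

Lemma central_block (P : pred 'I_N) :
  exists w : Z, forall m, chi m w = u m ^+ 2 *+ P (root m).
Proof.
pose c := \sum_(m | P (root m)) x m m * x m m.
have c_entry s t : theta c s t = u s ^+ 2 *+ ((s == t) && P (root s)).
  have -> : theta c = \sum_(m | P (root m)) u m ^+ 2 *: delta_mx m m.
    rewrite rmorph_sum; apply: eq_bigr => m _.
    rewrite !rmorphM -!mulmxE !xE // -!scalemxAl -scalemxAr mul_delta_mx scalerA.
    by rewrite -expr2.
  rewrite summxE; have [si|si] := boolP (P (root s)).
    rewrite (bigD1 s) //= big1 => [|m /andP[_ ms]].
      by rewrite !mxE eqxx addr0 andbT eq_sym mulr_natr.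
    by rewrite !mxE (eq_sym s) (negPf ms) mulr0.
  rewrite andbF mulr0n big1 // => m mi; rewrite !mxE; case: eqP => [sm|_]; last by rewrite mulr0.
  by rewrite sm mi in si.
have cC : c \in central A.
  apply: frame_central => [s t st|s]; first by rewrite c_entry (negPf st).
  by rewrite !c_entry !eqxx rootK u_root.
by exists (MkCenter cC) => m; rewrite chiE /= c_entry eqxx.
Qed.

Lemma regular_chi s : (s \in @regular Z) = [forall k, chi k s != 0].
Proof.
apply/asboolP/forallP => [s_reg k|s0 z z' /= e].
  have [w wE] := central_block (pred1 (root k)).
  have wk : chi k w != 0 by rewrite wE /= eqxx expf_neq0.
  apply: contraNneq wk => sk0; suff -> : w = 0 by rewrite rmorph0.
  apply: s_reg; apply: chi_inj => m; rewrite mulr0 rmorphM rmorph0 wE /=.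
  by case: eqP => [mk|_]; rewrite /= ?mulr0n ?mulr0 // -chi_root mk chi_root sk0 mul0r.
by apply: chi_inj => m; apply: (mulfI (s0 m)); rewrite -!rmorphM e.
Qed.

End FrameCenter.

Section FrameFull.
Variables (A : nzRingType) (K : fieldType) (N : nat).
Variables (theta : {rmorphism A -> 'M[K]_N}) (root : 'I_N -> 'I_N).
Variables (u : 'I_N -> K) (x : 'I_N -> 'I_N -> A).
Hypothesis frame : matrix_frame theta root u x.
Local Notation Z := (center A).
Local Notation T := (tensor_totfrac A).
Local Notation S := (GRing.MulClosed.clone Z (@regular Z) _).

Variable chi : 'I_N -> {rmorphism Z -> K}.
Hypothesis chiE : forall k z, chi k z = theta (val z) k k.

Definition block (k : 'I_N) : {set 'I_N} := [set i | root i == k].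
Definition block_index (k : 'I_N) (i : 'I_#|block k|) : 'I_N := enum_val i.

Lemma block_indexP k (i : 'I_#|block k|) : root (block_index i) = k.
Proof. by have := enum_valP i; rewrite inE => /eqP. Qed.

Let theta0 a i j : root i != root j -> theta a i j = 0.
Proof. by case: frame => _ _ H _ _; exact: H. Qed.

(** The block of a matrix in A is multiplicative because A is block diagonal, and
    regular central elements act on it by nonzero scalars. *)
Lemma block_representation (k : 'I_N) : root k = k ->
  exists F : {rmorphism T -> 'M[K]_#|block k|},
    forall a s (sS : s \in S) i j,
      F (pure_tensor _ a (frac 1 sS)) i j =
        theta a (block_index i) (block_index j) / chi k s.
Proof.
move=> rk; pose f a := mxsub (@block_index k) (@block_index k) (theta a).
have fB : zmod_morphism f by move=> a b; apply/matrixP => i j; rewrite /f rmorphB !mxE.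
have fM : GRing.monoid_morphism f.
  split=> [|a b]; apply/matrixP => i j.
    by rewrite /f rmorph1 !mxE (inj_eq enum_val_inj).
  rewrite -[RHS]/((f a *m f b) i j) /f rmorphM -mulmxE !mxE.
  rewrite (bigID (mem (block k))) /= [X in _ + X]big1 ?addr0 => [|m mk]; last first.
    by rewrite theta0 ?mul0r // block_indexP; move: mk; rewrite inE eq_sym.
  rewrite (reindex_onto (@block_index k) (enum_rank_in (enum_valP i))) /=.
    rewrite (eq_bigl xpredT) => [|m]; first by apply: eq_bigr => m _; rewrite !mxE.
    by rewrite /block_index enum_valP enum_valK_in eqxx.
  by move=> m mk; rewrite /block_index enum_rankK_in.
pose fA' := GRing.isZmodMorphism.Build _ _ f fB.
pose fM' := GRing.isMonoidMorphism.Build _ _ f fM.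
pose F : {rmorphism A -> 'M[K]_#|block k|} := HB.pack f fA' fM'.
have chi_S s : s \in S -> chi k s != 0.
  by move=> sS; have := regular_chi frame chiE s; rewrite sS => /esym/forallP.
have [g gE] := loc_lift chi_S.
pose h b : 'M[K]_#|block k| := (g b)%:M.
have hB : zmod_morphism h by move=> a b; rewrite /h rmorphB raddfB.
have hM : GRing.monoid_morphism h.
  by split=> [|a b]; rewrite /h ?rmorph1 // rmorphM scalar_mxM.
pose hA' := GRing.isZmodMorphism.Build _ _ h hB.
pose hM' := GRing.isMonoidMorphism.Build _ _ h hM.
pose H : {rmorphism totfrac Z -> 'M[K]_#|block k|} := HB.pack h hA' hM'.
have FH a b : F a * H b = H b * F a by exact: (scalar_mxC (g b) (f a)).
have Fz (z : Z) : F (val z) = H (totfrac_of Z z).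
  rewrite /= /f /h loc_ofE gE rmorph1 divr1; apply/matrixP => i j; rewrite !mxE.
  rewrite (theta_centerE frame chiE) (inj_eq enum_val_inj).
  by rewrite -(chi_root frame chiE) block_indexP.
have [G GE] := tensor_lift FH Fz.
exists G => a s sS i j; rewrite GE -[_ * _]/(f a *m h _) /h gE rmorph1 mul1r mul_mx_scalar.
by rewrite !mxE mulrC.
Qed.

Let u0 i : u i != 0. Proof. by case: frame => _ _ _ /(_ i)[]. Qed.
Let rootK i : root (root i) = root i. Proof. by case: frame. Qed.
Let theta_inj : injective theta. Proof. by case: frame. Qed.

(** Multiples of the idempotent of a block separate the kernels of the characters,
    which is how these kernels turn out to be the minimal primes. *)
Lemma annihilator (k : 'I_N) : exists w : Z, [/\ chi k w != 0,
  forall z, chi k z = 0 -> w * z = 0 & forall j, root j != root k -> chi j w = 0].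
Proof.
have [w wE] := central_block frame chiE (pred1 (root k)); exists w; split.
- by rewrite wE /= eqxx expf_neq0.
- move=> z zk; apply: (chi_inj frame chiE) => m; rewrite rmorphM rmorph0 wE /=.
  case: eqP => [mk|_]; last by rewrite mul0r.
  by rewrite -(chi_root frame chiE m) mk (chi_root frame chiE) zk mulr0.
by move=> j jk; rewrite wE /= (negPf jk).
Qed.

(** Each multiple of a matrix unit of a block by a fraction of the center, and zero on
    the other blocks, comes from A.  The given denominator s need only be nonzero on
    the block, so it is completed to a regular element by the idempotents of the other
    blocks. *)
Lemma frame_surjective (i j : 'I_N) (z s : Z) : root i = root j -> chi i s != 0 ->
  exists a (t : Z) (tS : t \in S), forall m m', root m = root m' ->
    theta a m m' / chi m t = chi i z / chi i s *+ ((m == i) && (m' == j)).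
Proof.
move=> ij si.
have [w wE] := central_block frame chiE (pred1 (root i)).
have [w' wE'] := central_block frame chiE (predC1 (root i)).
have tE m : chi m (s * w + w') = if root m == root i then chi i s * u m ^+ 2 else u m ^+ 2.
  rewrite rmorphD rmorphM wE wE' /=; case: eqP => [mi|_]; rewrite ?mulr0 ?add0r ?addr0 //.
  by rewrite -(chi_root frame chiE m) mi (chi_root frame chiE).
have tS : s * w + w' \in S.
  rewrite (regular_chi frame chiE); apply/forallP => m; rewrite tE.
  by case: ifP => _; rewrite ?mulf_neq0 ?expf_neq0.
exists (x i i * x i j * val z), _, tS => m m' mm'.
case: frame => _ _ _ _ xE.
rewrite tE !rmorphM -!mulmxE !xE // -scalemxAl -scalemxAr mul_delta_mx -!scalemxAl scalerA.
rewrite mxE mulmx_deltal (theta_centerE frame chiE) -mulrnA mulnb.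
have [->|mi] := eqVneq m i; last first.
  by rewrite andbF mulr0n mulr0 mul0r.
rewrite !eqxx andbT /= (eq_sym m'); case: eqP => [_|_]; last by rewrite mulr0 mul0r.
rewrite !mulr1n -(chi_root frame chiE j) -ij (chi_root frame chiE) -expr2.
by field; rewrite si u0.
Qed.

(** The components of the isomorphism are the blocks of theta.  Their entries are
    fractions of elements of the center by central_coefficient, so they descend from K
    to the localizations, which embed in K.  A prime that contained none of the
    kernels of the characters would contain a product of elements of all of them, and
    that product is zero. *)
Lemma frame_full : full A N.
Proof.
pose R := [set k | root k == k]; pose rt (c : 'I_#|R|) : 'I_N := enum_val c.
have rtE c : root (rt c) = rt c by have := enum_valP c; rewrite inE => /eqP.
have rt_inj : injective rt by exact: enum_val_inj.
have rootR i : exists c, rt c = root i.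
  have iR : root i \in R by rewrite inE rootK.
  by exists (enum_rank_in iR (root i)); rewrite /rt enum_rankK_in.
pose P c : prime_idealr Z := rkernel (chi (rt c)).
pose n c := #|block (rt c)|.
have block0 c : rt c \in block (rt c) by rewrite inE rtE.
have /fin_all_exists[F FE] c := block_representation (rtE c).
have iota c : exists2 f : {rmorphism loc_at (P c) -> K}, injective f
    & forall a s sS, f (@frac _ _ a s sS) = chi (rt c) a / chi (rt c) s.
  by apply: loc_at_lift; have [w [w1 w2 _]] := annihilator (rt c); exists w.
have {iota}/fin_all_exists2[iota iota_inj iotaE] := iota.
have chi_S c s : s \in S -> chi (rt c) s != 0.
  by rewrite (regular_chi frame chiE) => /forallP.
have image c t i j : exists y, iota c y = F c t i j.
  have [a [s [sS ->]]] := tensor_pure t; rewrite FE.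
  have [|z zE] := central_coefficient frame chiE a (i := block_index i) (j := block_index j).
    by rewrite !block_indexP.
  have [w wE] := central_block frame chiE (pred1 (rt c)).
  have wS : w * s \in prime_compl (P c).
    rewrite -[X in is_true X]/(w * s \notin P c) rkernelE rmorphM mulf_eq0 negb_or (chi_S c _ sS) andbT wE /= rtE eqxx.
    by rewrite expf_neq0.
  exists (frac z wS); rewrite iotaE rmorphM zE wE /= rtE block_indexP eqxx.
  case: frame => _ _ _ uP _; rewrite -(uP (block_index i)).2 block_indexP.
  by rewrite !mulr1n; field; rewrite u0 (chi_S c _ sS).
have /fin_all_exists[Phi PhiE] c := lift_matrices (iota_inj c) (image c).
exists #|R|, P, n, Phi; split.
- split=> [c Q QP z|c d cd|Q Qmin].
  + rewrite rkernelE => /eqP zc; have [w [wc wz _]] := annihilator (rt c).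
    have : w * z \in Q by rewrite wz // rpred0.
    by rewrite prime_idealrM => /orP[/QP|//]; rewrite rkernelE (negPf wc).
  + have [w [wc _ wd]] := annihilator (rt c); apply/rt_inj/eqP.
    have := cd w; rewrite !rkernelE (negPf wc) => /esym/negbT.
    by apply: contraNT => dc; rewrite wd ?eqxx // !rtE eq_sym.
  (* Otherwise Q misses an element of each kernel, but it contains their product. *)
  have [c QP] : exists c, {subset P c <= Q}.
    apply: contrapT => /forallNP H.
    have /fin_all_exists2[z zP zQ] c : exists2 z, z \in P c & z \notin Q.
      by apply: contrapT => Hc; apply: (H c) => z zP; apply: contrapT => /negP zQ; apply: Hc; exists z.
    have : \prod_c z c \notin Q.
      elim/big_rec: _ => [|c y _ yQ]; first by rewrite idealr1.
      by rewrite prime_idealrM negb_or zQ.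
    suff -> : \prod_c z c = 0 by rewrite rpred0.
    apply: (chi_inj frame chiE) => m; rewrite rmorph0 rmorph_prod -(eq_bigr _ (fun _ _ => erefl)).
    have [c cm] := rootR m; apply/eqP/prodf_eq0; exists c => //.
    by rewrite -(chi_root frame chiE) -cm -rkernelE.
  by exists c => z; apply/idP/idP; [apply: Qmin | exact: QP].
- move=> z c; have mf_inj (M M' : 'M[loc_at (P c)]_(n c)) :
      map_mx (iota c) M = map_mx (iota c) M' -> M = M'.
    move=> /matrixP e; apply/matrixP => i j; apply: iota_inj; have := e i j; rewrite !mxE; exact.
  apply: mf_inj; rewrite PhiE map_scalar_mx; apply/matrixP => i j.
  rewrite [1 in LHS](_ : 1 = frac 1 (rpred1 S)) // FE mxE rmorph1 divr1.
  rewrite (theta_centerE frame chiE) (inj_eq enum_val_inj) -(chi_root frame chiE) block_indexP.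
  by rewrite /= loc_ofE iotaE rmorph1 divr1.
- move=> M; have PhiP t : (forall c, Phi c t = M c) <->
      (forall c i j, F c t i j = iota c (M c i j)).
    split=> e c; first by move=> i j; rewrite -PhiE mxE e.
    by apply/matrixP => i j; apply: iota_inj; rewrite -e -PhiE mxE.
  (* Add up preimages of the single entries of all the matrices. *)
  have [t tM] : exists t, forall c i j, F c t i j = iota c (M c i j).
    have H c i j : exists t, forall d k l, F d t k l =
        iota c (M c i j) *+ ((block_index k == block_index i) && (block_index l == block_index j)).
      have [z [s [sS ->]]] := fracP (M c i j); rewrite iotaE.
      have si : chi (block_index i) s != 0.
        by rewrite -(chi_root frame chiE) block_indexP.
      have [|a [t [tS aE]]] := frame_surjective z _ si (j := block_index j).
        by rewrite !block_indexP.
      exists (pure_tensor _ a (frac 1 tS)) => d k l; rewrite FE.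
      have dk : chi (rt d) t = chi (block_index k) t.
        by rewrite -(chi_root frame chiE (block_index k)) block_indexP.
      rewrite dk aE ?block_indexP //.
      by rewrite -!(chi_root frame chiE (block_index i)) !block_indexP.
    have {H}/fin_all_exists[t tE] c := fin_all_exists (fun i => fin_all_exists (H c i)).
    exists (\sum_c \sum_i \sum_j t c i j) => c i j.
    rewrite rmorph_sum summxE (bigD1 c) //= [X in _ + X]big1 ?addr0 => [|d dc]; last first.
      rewrite rmorph_sum summxE big1 // => k _; rewrite rmorph_sum summxE big1 // => l _.
      rewrite tE; case: eqP => // e; case/eqP: dc; apply: rt_inj.
      by rewrite -(block_indexP i) e block_indexP.
    rewrite rmorph_sum summxE (bigD1 i) //= [X in _ + X]big1 ?addr0 => [|k ki]; last first.
      rewrite rmorph_sum summxE big1 // => l _; rewrite tE (inj_eq enum_val_inj).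
      by rewrite eq_sym (negPf ki).
    rewrite rmorph_sum summxE (bigD1 j) //= [X in _ + X]big1 ?addr0 => [|l lj]; last first.
      by rewrite tE !(inj_eq enum_val_inj) (eq_sym j) (negPf lj) andbF.
    by rewrite tE !eqxx.
  exists t; split=> [|t' /PhiP tM']; first exact/PhiP.
  apply/eqP; rewrite -subr_eq0; apply/eqP.
  have : forall c i j, F c (t - t') i j = 0.
    by move=> c i j; rewrite rmorphB !mxE tM tM' subrr.
  have [a [s [sS ->]]] := tensor_pure (t - t') => H.
  suff -> : a = 0 by rewrite pure_tensor0.
  apply: theta_inj; rewrite rmorph0; apply/matrixP => i j; rewrite mxE.
  have [ij|/theta0->//] := eqVneq (root i) (root j).
  have [c ci] := rootR i.
  have iB : i \in block (rt c) by rewrite inE ci.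
  have jB : j \in block (rt c) by rewrite inE ci ij.
  have := H c (enum_rank_in iB i) (enum_rank_in jB j); rewrite FE /block_index !enum_rankK_in //.
  by move/eqP; rewrite mulf_eq0 invr_eq0 (negPf (chi_S _ _ sS)) orbF => /eqP.
- by move=> c; apply/card_gt0P; exists (rt c).
rewrite /n; apply: (etrans _ (card_ord N)); rewrite -[RHS]sum1_card.
have /fin_all_exists[cls clsE] := rootR.
rewrite (partition_big cls xpredT) //=; apply: eq_bigr => c _.
rewrite -sum1_card; apply: eq_bigl => i; rewrite inE -clsE.
by rewrite (inj_eq rt_inj).
Qed.

End FrameFull.

(** * Fullness and orthogonal symmetric elements *)

Section FullAlgebra.
Variables (A : nzRingType) (N : nat).
Local Notation Z := (center A).
Local Notation T := (tensor_totfrac A).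
Local Notation S := (GRing.MulClosed.clone Z (@regular Z) _).

Lemma loc_at_neq0 (P : prime_idealr Z) : (1 : loc_at P) != 0.
Proof.
apply/eqP => e; have [u uS] := frac_eqP (e : frac 1 (rpred1 _) = frac 0 (rpred1 _)).
rewrite mulr1 mul0r subr0 mulr1 => u0; move: uS; rewrite u0.
by rewrite -[X in is_true X]/(0 \notin P) rpred0.
Qed.

(** Pull back the diagonal matrix units of the direct sum. *)
Lemma full_idempotents : full A N ->
  exists (I : finType) (e : I -> T), [/\ #|I| = N, forall i, e i != 0,
    forall i, e i * e i = e i & forall i j, i != j -> e i * e j = 0].
Proof.
move=> [r [P [n [Phi [_ _ Phi_bij n0 <-]]]]].
pose I := {c : 'I_r & 'I_(n c)}.
pose M (p : I) d : 'M[loc_at (P d)]_(n d) := \matrix_(a, b)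
  ([&& d == tag p, a == tagged p :> nat & b == tagged p :> nat])%:R.
have M_same c j : M (Tagged (fun c => 'I_(n c)) j) c = delta_mx j j.
  by apply/matrixP => a b; rewrite !mxE eqxx.
have M_other p d : d != tag p -> M p d = 0.
  by move=> dp; apply/matrixP => a b; rewrite !mxE (negPf dp).
have MM p q d : M p d * M q d = M p d *+ (p == q).
  have [dp|dp] := eqVneq d (tag p); last by rewrite M_other // mul0r mul0rn.
  have [dq|dq] := eqVneq d (tag q); last first.
    rewrite (M_other q) // mulr0; case: eqP => // pq.
    by rewrite -pq -dp eqxx in dq.
  case: p q dp dq => c j [c' j'] /= dc dc'; subst d; subst c'.
  rewrite !M_same -mulmxE mul_delta_mx_cond eq_Tagged /=.
  by case: eqP => [->|].
have Phi_inj t t' : (forall d, Phi d t = Phi d t') -> t = t'.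
  move=> tt'; have [s [_ s_uniq]] := Phi_bij (fun d => Phi d t').
  by rewrite -(s_uniq t tt') -(s_uniq t').
have [e eM] : exists e : I -> T, forall p d, Phi d (e p) = M p d.
  have H p : exists t, forall d, Phi d t = M p d.
    by have [t [tM _]] := Phi_bij (M p); exists t.
  exact: (fin_all_exists H).
exists I, e; split.
- rewrite card_tagged sumnE big_map big_enum /=.
  by apply: eq_bigr => c _; rewrite card_ord.
- move=> [c j]; apply/eqP => e0; have := eM (Tagged (fun c => 'I_(n c)) j) c.
  rewrite M_same e0 rmorph0 => /matrixP/(_ j j)/eqP; rewrite !mxE !eqxx eq_sym.
  by rewrite (negPf (loc_at_neq0 (P c))).
- by move=> p; apply: Phi_inj => d; rewrite rmorphM !eM MM eqxx.
- by move=> p q pq; apply: Phi_inj => d; rewrite rmorphM !eM MM (negPf pq) rmorph0.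
Qed.

(** The numerators of the idempotents of full_idempotents are orthogonal up to torsion,
    and multiplying them by a common annihilator U of that torsion makes them exactly
    orthogonal.  Their squares survive since U is invertible in the tensor product. *)
Lemma full_orthogonal_family : full A N -> exists b : 'I_N -> A,
  (forall i j, i != j -> b i * b j = 0) /\ (forall i, b i * b i != 0).
Proof.
move=> /full_idempotents[I [e [cardI e0 ee eo]]].
suff [b [bo bb]] : exists b : I -> A,
    (forall i j, i != j -> b i * b j = 0) /\ (forall i, b i * b i != 0).
  exists (fun i => b (enum_val (cast_ord (esym cardI) i))); split=> [i j ij|i]; last exact: bb.
  by apply: bo; rewrite (inj_eq enum_val_inj) (inj_eq (@cast_ord_inj _ _ _)).
have /fin_all_exists[a /fin_all_exists[s /fin_all_exists[sS eE]]] i := tensor_pure (e i).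
have pureM i j : e i * e j =
    pure_tensor (totfrac_of Z) (a i * a j) (frac 1 (rpredM (sS i) (sS j))).
  rewrite !eE pure_tensorM fracM; congr (pure_tensor _ _ _).
  by apply: frac_eq; rewrite mulr1.
have /fin_all_exists[u uP] i : exists u : I -> Z,
    forall j, u j \in S /\ (i != j -> a i * a j * val (u j) = 0).
  suff H j : exists v : Z, v \in S /\ (i != j -> a i * a j * val v = 0).
    exact: (fin_all_exists H).
  have [ij|ij] := eqVneq i j; first by exists 1; rewrite rpred1.
  have [|u uS au] := @tensor_torsion A (a i * a j) _ (rpredM (sS i) (sS j)).
    by rewrite -pureM eo.
  by exists u.
pose U := \prod_i \prod_j u i j.
have US : U \in S by apply: rpred_prod => i _; apply: rpred_prod => j _; case: (uP i j).
have bE i j : (a i * val U) * (a j * val U) = a i * a j * val (U * U).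
  by rewrite /= !mulrA -(mulrA (a i)) centerP !mulrA.
exists (fun i => a i * val U); split=> [i j ij|i]; rewrite bE.
  have -> : U * U = u i j * ((\prod_(k | k != j) u i k) *
      (\prod_(k | k != i) \prod_j u k j) * U).
    by rewrite {1}/U (bigD1 i) //= (bigD1 j) //= !mulrA.
  by rewrite /= (mulrA (a i * a j) (val (u i j))) (uP i j).2 // mul0r.
apply: contraNneq (e0 i) => aU; rewrite -ee pureM.
by rewrite -(pure_tensor_cancel _ (rpredM US US)) aU pure_tensor0.
Qed.

End FullAlgebra.

Section InvolutiveAlgebra.
Variables (A : nzRingType) (adj : A -> A).
Hypotheses (adjD : {morph adj : a b / a + b}) (adjM : forall a b, adj (a * b) = adj b * adj a)
  (adjK : involutive adj) (adj_def : forall a, a * adj a = 0 -> a = 0).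
Variables (K : fieldType) (N : nat) (rho : {rmorphism A -> 'M[K]_N}).
Hypothesis rho_inj : injective rho.

(** With s the central sum of the x i i of a frame, the sum of the symmetric elements
    x i i (adj (x i i)) is s (adj s), because x i i lies in V i A V i and so is
    orthogonal to the adjoints of the others.  It is regular as s acts by nonzero
    scalars on the blocks. *)
Lemma orthogonal_symmetric_central (V : 'I_N -> A) : orthogonal_symmetric adj V ->
  exists V' : 'I_N -> A, [/\ orthogonal_symmetric adj V', \sum_i V' i \in central A
    & GRing.lreg (\sum_i V' i) /\ GRing.rreg (\sum_i V' i)].
Proof.
move=> oV; have [Vs V0 Vo] := oV.
have [theta [root [u [x [frame xV]]]]] := frame_exists adjD adjM adjK adj_def rho_inj oV.
have [theta_inj rootK _ uP xE] := frame.
have x_orth i j : i != j -> x i i * adj (x j j) = 0.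
  move=> ij; have [y ->] := xV i; have [z ->] := xV j.
  by rewrite !adjM !Vs !mulrA -(mulrA _ (V i)) Vo // mulr0 !mul0r.
have x'_orth i j : i != j -> adj (x i i) * x j j = 0.
  move=> ij; have [y ->] := xV i; have [z ->] := xV j.
  by rewrite !adjM !Vs !mulrA -(mulrA _ (V i)) Vo // mulr0 !mul0r.
pose s := \sum_i x i i.
have theta_s i j : theta s i j = u i *+ (i == j).
  rewrite rmorph_sum summxE (bigD1 i) //= big1 => [|k ki]; last first.
    by rewrite xE // !mxE (eq_sym i) (negPf ki) mulr0.
  by rewrite addr0 xE // !mxE eqxx (eq_sym j) mulr_natr.
have sC : s \in central A.
  apply: (frame_central frame) => [i j ij|i]; first by rewrite theta_s (negPf ij).
  by rewrite !theta_s !eqxx (uP i).2.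
have s_comm a : s * a = a * s by move/asboolP: sC; apply.
have s_lreg : GRing.lreg s.
  move=> a b /= e; apply: theta_inj; apply/matrixP => i j; apply: (mulfI (uP i).1).
  have : (theta s *m theta a) i j = (theta s *m theta b) i j by rewrite !mulmxE -!rmorphM e.
  have th c : (theta s *m theta c) i j = u i * theta c i j.
    rewrite mxE (bigD1 i) //= big1 => [|k ki]; last by rewrite theta_s eq_sym (negPf ki) mul0r.
    by rewrite addr0 theta_s eqxx.
  by rewrite !th.
have adj_sum (I : finType) (F : I -> A) : adj (\sum_i F i) = \sum_i adj (F i).
  exact: (big_morph adj adjD (adj0 adjD)).
have s'_comm a : adj s * a = a * adj s.
  by apply: (inv_inj adjK); rewrite !adjM adjK s_comm.
have s'_lreg : GRing.lreg (adj s).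
  move=> a b /= e; apply: (inv_inj adjK); apply: s_lreg; rewrite /= !s_comm.
  by apply: (inv_inj adjK); rewrite !adjM !adjK.
have sumE : \sum_i x i i * adj (x i i) = s * adj s.
  rewrite /s adj_sum mulr_suml; apply: eq_bigr => i _.
  by rewrite mulr_sumr (bigD1 i) //= big1 ?addr0 // => j ji; rewrite x_orth // eq_sym.
have sum_lreg : GRing.lreg (s * adj s) by apply: lregM.
have sum_comm a : s * adj s * a = a * (s * adj s).
  by rewrite -mulrA s'_comm mulrA s_comm -mulrA.
exists (fun i => x i i * adj (x i i)); rewrite sumE; split.
- split=> [i|i|i j ij].
  + by rewrite adjM adjK.
  + apply/eqP => /adj_def x0; have := xE i i erefl; rewrite x0 rmorph0.
    by move/matrixP/(_ i i)/eqP; rewrite !mxE !eqxx mulr1 eq_sym (negPf (uP i).1).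
  + by rewrite !mulrA -(mulrA (x i i)) x'_orth // mulr0 mul0r.
- exact/asboolP.
by split=> // a b /=; rewrite -!sum_comm => /sum_lreg.
Qed.

Theorem full_iff_orthogonal_symmetric :
  full A N <-> exists V : 'I_N -> A, [/\ orthogonal_symmetric adj V, \sum_i V i \in central A
    & GRing.lreg (\sum_i V i) /\ GRing.rreg (\sum_i V i)].
Proof.
split=> [/full_orthogonal_family[b [bo bb]]|[V [oV _ _]]].
  have [rho' [l [rho'_inj bl]]] := diagonal_representation rho_inj bo bb.
  have [V oV] := gram_schmidt adjD adjM adjK adj_def rho'_inj bl.
  exact: orthogonal_symmetric_central oV.
have [theta [root [u [x [frame _]]]]] := frame_exists adjD adjM adjK adj_def rho_inj oV.
have [chi chiE] := frame_characters frame.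
exact: (@frame_full A K N theta root u x frame chi chiE).
Qed.

End InvolutiveAlgebra.

(** * Moments and the matrix-valued inner product *)

Section ComplexIntegral.
Variable R : realType.
Local Notation C := R[i].
Local Notation mu := (@lebesgue_measure R).
Local Open Scope complex_scope.
Implicit Types (f g : R -> C) (c : C).

Definition cintegrable f : Prop :=
  mu.-integrable setT (fun x => (complex.Re (f x))%:E) /\
  mu.-integrable setT (fun x => (complex.Im (f x))%:E).

Lemma cintegrable0 : cintegrable (fun=> 0).
Proof. by split; exact: integrable0. Qed.

Lemma cintegrableD f g : cintegrable f -> cintegrable g ->
  cintegrable (fun x => f x + g x).
Proof.
move=> [rf jf] [rg jg]; split.
  apply: eq_integrable (integrableD measurableT rf rg) => // x _ /=.
  by case: (f x) (g x) => [a b] [a' b'].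
apply: eq_integrable (integrableD measurableT jf jg) => // x _ /=.
by case: (f x) (g x) => [a b] [a' b'].
Qed.

Lemma cintegralD f g : cintegrable f -> cintegrable g ->
  cintegral (fun x => f x + g x) = cintegral f + cintegral g.
Proof.
move=> [rf jf] [rg jg]; rewrite /cintegral; apply/eqP; rewrite eq_complex /=.
by rewrite -!RintegralD //; apply/andP; split; apply/eqP/eq_Rintegral => x _ /=;
  case: (f x) (g x) => [a b] [a' b'].
Qed.

Lemma cintegrableZ c f : cintegrable f -> cintegrable (fun x => c * f x).
Proof.
case: c => [c d] [rf jf]; split.
  have := integrableD measurableT (integrableZl measurableT c rf) (integrableZl measurableT (- d) jf).
  apply: eq_integrable => // x _ /=; case: (f x) => [a b] /=.
  by rewrite -!EFinM -EFinD mulNr.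
have := integrableD measurableT (integrableZl measurableT c jf) (integrableZl measurableT d rf).
by apply: eq_integrable => // x _ /=; case: (f x) => [a b] /=; rewrite -!EFinM -EFinD.
Qed.

Lemma cintegralZ c f : cintegrable f -> cintegral (fun x => c * f x) = c * cintegral f.
Proof.
case: c => [c d] [rf jf]; rewrite /cintegral; apply/eqP; rewrite eq_complex /=.
have Z (k : R) (h : R -> R) : mu.-integrable setT (fun x => (h x)%:E) ->
    mu.-integrable setT (fun x => (k * h x)%:E).
  by move=> hi; apply: eq_integrable (integrableZl measurableT k hi).
rewrite -!RintegralZl // -RintegralB ?Z // -RintegralD ?Z //.
by apply/andP; split; apply/eqP/eq_Rintegral => x _ /=; case: (f x) => [a b].
Qed.

Lemma cintegrable_sum (I : Type) (s : seq I) (F : I -> R -> C) :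
  (forall i, cintegrable (F i)) -> cintegrable (fun x => \sum_(i <- s) F i x).
Proof.
move=> FI; elim: s => [|i s IHs].
  by under eq_fun do rewrite big_nil; exact: cintegrable0.
by under eq_fun do rewrite big_cons; exact: cintegrableD.
Qed.

Lemma cintegral_sum (I : Type) (s : seq I) (F : I -> R -> C) :
  (forall i, cintegrable (F i)) ->
  cintegral (fun x => \sum_(i <- s) F i x) = \sum_(i <- s) cintegral (F i).
Proof.
move=> FI; elim: s => [|i s IHs].
  under eq_fun do rewrite big_nil.
  by rewrite big_nil /cintegral /Rintegral /= integral0.
under eq_fun do rewrite big_cons.
by rewrite cintegralD ?big_cons ?IHs //; exact: cintegrable_sum.
Qed.

Lemma conjCE (c : C) : Num.conj c = conjc c.
Proof. by []. Qed.

Lemma cintegral_conj f : cintegrable f ->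
  cintegral (fun x => Num.conj (f x)) = Num.conj (cintegral f).
Proof.
move=> [rf jf]; rewrite !conjCE /cintegral /=; congr (_ +i* _).
  by apply: eq_Rintegral => x _; case: (f x).
rewrite -mulN1r -RintegralZl //; apply: eq_Rintegral => x _.
by rewrite conjCE; case: (f x) => a b /=; rewrite mulN1r.
Qed.

End ComplexIntegral.

Section MatrixCoefficients.
Variables (K : comNzRingType) (n : nat).
Implicit Types (P Q : 'M[{poly K}]_n).

Definition mxcoef (k : nat) P : 'M[K]_n := map_mx (fun p : {poly K} => p`_k) P.

Definition size_le (s : nat) P : Prop := forall i j, (size (P i j) <= s)%N.

Lemma size_le_exists P : exists s, size_le s P.
Proof.
exists (\max_i \max_j size (P i j))%N => i j.
by rewrite (leq_trans _ (leq_bigmax i)) // (leq_bigmax j).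
Qed.

Lemma size_leW s t P : (s <= t)%N -> size_le s P -> size_le t P.
Proof. by move=> st Ps i j; exact: leq_trans st. Qed.

Lemma mxcoefD k P Q : mxcoef k (P + Q) = mxcoef k P + mxcoef k Q.
Proof. by apply/matrixP => i j; rewrite !mxE coefD. Qed.

Lemma mxcoefB k P Q : mxcoef k (P - Q) = mxcoef k P - mxcoef k Q.
Proof. by apply/matrixP => i j; rewrite !mxE coefB. Qed.

Lemma mxcoef_constl k (L : 'M[K]_n) P : mxcoef k (map_mx polyC L *m P) = L *m mxcoef k P.
Proof.
apply/matrixP => i j; rewrite !mxE coef_sum; apply: eq_bigr => l _.
by rewrite !mxE coefCM.
Qed.

Lemma mxcoefX k P : mxcoef k ('X *: P) = if k is k'.+1 then mxcoef k' P else 0.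
Proof.
by case: k => [|k]; apply/matrixP => i j; rewrite !mxE coefXM.
Qed.

Lemma size_leD s P Q : size_le s P -> size_le s Q -> size_le s (P + Q).
Proof.
by move=> Ps Qs i j; rewrite mxE (leq_trans (size_polyD _ _)) // geq_max Ps Qs.
Qed.

Lemma size_leN s P : size_le s P -> size_le s (- P).
Proof. by move=> Ps i j; rewrite mxE size_polyN. Qed.

Lemma size_leX s P : size_le s P -> size_le s.+1 ('X *: P).
Proof.
move=> Ps i j; rewrite mxE; have [->|p0] := eqVneq (P i j) 0.
  by rewrite mulr0 size_poly0.
by rewrite mulrC size_mulX // ltnS.
Qed.

Lemma size_le_constl s (L : 'M[K]_n) P : size_le s P -> size_le s (map_mx polyC L *m P).
Proof.
move=> Ps i j; rewrite mxE; apply: (leq_trans (size_sum _ _ _)).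
apply/bigmax_leqP => l _; rewrite mxE mul_polyC.
exact: leq_trans (size_scale_leq _ _) (Ps _ _).
Qed.

Lemma size_le_coef s P : size_le s P <-> forall k, (s <= k)%N -> mxcoef k P = 0.
Proof.
split=> [Ps k sk|P0 i j]; first by apply/matrixP => i j; rewrite !mxE nth_default // (leq_trans (Ps i j)).
by apply/leq_sizeP => k /P0/matrixP/(_ i j); rewrite !mxE.
Qed.

Lemma mxcoef_inj P Q : (forall k, mxcoef k P = mxcoef k Q) -> P = Q.
Proof.
move=> e; apply/matrixP => i j; apply/polyP => k.
by have /matrixP/(_ i j) := e k; rewrite !mxE.
Qed.

End MatrixCoefficients.

Section Moments.
Variables (R : realType) (n : nat) (x0 x1 : \bar R) (W : R -> 'M[R[i]]_n).
Hypothesis hW : weight_matrix x0 x1 W.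
Local Notation C := R[i].
Local Open Scope sesquilinear_scope.
Implicit Types (P Q : 'M[{poly C}]_n) (L : 'M[C]_n).

Definition moment (k : nat) : 'M[C]_n :=
  \matrix_(i, j) cintegral (fun x => (x ^+ k)%:C%C * W x i j).

Lemma cintegrable_moment k i j : cintegrable (fun x => (x ^+ k)%:C%C * W x i j).
Proof.
have [_ _ _ _ /(_ k i j)[rW jW]] := hW.
split; [apply: eq_integrable rW => //|apply: eq_integrable jW => //] => x _ /=;
  by case: (W x i j) => a b /=; rewrite mul0r ?subr0 ?addr0.
Qed.

Lemma weight_herm x : (W x)^t* = W x.
Proof.
have [[_ /(_ x) /is_hermitianmxP e] _ _ _ _] := hW.
by rewrite [RHS]e expr0 scale1r.
Qed.

Lemma moment_herm k : (moment k)^t* = moment k.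
Proof.
apply/matrixP => i j; rewrite !mxE -cintegral_conj; last exact: cintegrable_moment.
congr cintegral; apply/funext => x; rewrite rmorphM -[in RHS]weight_herm !mxE.
by rewrite [X in X * _]conjCE conjc_real.
Qed.

Lemma mxeval_coef s P x : size_le s P ->
  mxeval P x = \sum_(a < s) (x ^+ a)%:C%C *: mxcoef a P.
Proof.
move=> Ps; apply/matrixP => i j; rewrite !mxE (horner_coef_wide _ (Ps i j)) summxE.
by apply: eq_bigr => a _; rewrite !mxE mulrC rmorphXn.
Qed.

Lemma cintegrable_pairing s t P Q (a : 'I_s) (b : 'I_t) i j (l k : 'I_n) :
  cintegrable (fun x => mxcoef a P i k * Num.conj (mxcoef b Q j l) *
    ((x ^+ (a + b))%:C%C * W x k l)).
Proof. exact/cintegrableZ/cintegrable_moment. Qed.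

Lemma pairing_expand s t P Q i j : size_le s P -> size_le t Q ->
  (fun x => (mxeval P x *m W x *m (mxeval Q x)^t*) i j) =
  (fun x => \sum_(a < s) \sum_(b < t) \sum_l \sum_k
    mxcoef a P i k * Num.conj (mxcoef b Q j l) * ((x ^+ (a + b))%:C%C * W x k l)).
Proof.
move=> Ps Qt; apply/funext => x.
rewrite (mxeval_coef x Ps) (mxeval_coef x Qt) !mulmx_suml summxE; apply: eq_bigr => a _.
rewrite linear_sum raddf_sum /= mulmx_sumr summxE; apply: eq_bigr => b _.
rewrite mxE; apply: eq_bigr => l _; rewrite mxE mulr_suml; apply: eq_bigr => k _.
rewrite !mxE rmorphM exprD rmorphM [X in _ * (X * _)]conjCE conjc_real; ring.
Qed.

(** All the algebra of the inner product comes from this formula: sesquilinearity is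
    visible in it, the symmetry of multiplication by x expresses that the moments only
    depend on a + b, and the moments are Hermitian since W is. *)
Lemma wdot_moment s t P Q : size_le s P -> size_le t Q ->
  wdot W P Q = \sum_(a < s) \sum_(b < t) mxcoef a P *m moment (a + b) *m (mxcoef b Q)^t*.
Proof.
move=> Ps Qt; apply/matrixP => i j; rewrite mxE (pairing_expand i j Ps Qt).
rewrite cintegral_sum => [|a]; last by do 3![apply: cintegrable_sum => ?]; exact: cintegrable_pairing.
rewrite summxE; apply: eq_bigr => a _.
rewrite cintegral_sum => [|b]; last by do 2![apply: cintegrable_sum => ?]; exact: cintegrable_pairing.
rewrite summxE; apply: eq_bigr => b _.
rewrite cintegral_sum => [|l]; last by apply: cintegrable_sum => ?; exact: cintegrable_pairing.
rewrite mxE; apply: eq_bigr => l _.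
rewrite cintegral_sum => [|k]; last exact: cintegrable_pairing.
rewrite [in RHS]mxE mulr_suml; apply: eq_bigr => k _.
rewrite cintegralZ; last exact: cintegrable_moment.
by rewrite !mxE mulrAC.
Qed.

Lemma wdotDl P P' Q : wdot W (P + P') Q = wdot W P Q + wdot W P' Q.
Proof.
have [s Ps] := size_le_exists P; have [s' Ps'] := size_le_exists P'.
have [t Qt] := size_le_exists Q.
have {}Ps := size_leW (leq_maxl s s') Ps; have {}Ps' := size_leW (leq_maxr s s') Ps'.
rewrite (wdot_moment Ps Qt) (wdot_moment Ps' Qt) (wdot_moment (size_leD Ps Ps') Qt).
rewrite -big_split; apply: eq_bigr => a _; rewrite -big_split; apply: eq_bigr => b _ /=.
by rewrite mxcoefD !mulmxDl.
Qed.

Lemma wdot_constl L P Q : wdot W (map_mx polyC L *m P) Q = L *m wdot W P Q.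
Proof.
have [s Ps] := size_le_exists P; have [t Qt] := size_le_exists Q.
rewrite (wdot_moment Ps Qt) (wdot_moment (size_le_constl L Ps) Qt).
rewrite mulmx_sumr; apply: eq_bigr => a _; rewrite mulmx_sumr; apply: eq_bigr => b _.
by rewrite mxcoef_constl !mulmxA.
Qed.

Lemma wdot_herm P Q : wdot W Q P = (wdot W P Q)^t*.
Proof.
have [s Ps] := size_le_exists P; have [t Qt] := size_le_exists Q.
rewrite (wdot_moment Ps Qt) (wdot_moment Qt Ps) exchange_big linear_sum raddf_sum /=.
apply: eq_bigr => a _; rewrite linear_sum raddf_sum /=; apply: eq_bigr => b _.
rewrite !trmx_mul !map_mxM /= -map_trmx moment_herm addnC mulmxA; congr (_ *m _ *m _).
by rewrite trmxCK.
Qed.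

Lemma wdotX P Q : wdot W ('X *: P) Q = wdot W P ('X *: Q).
Proof.
have [s Ps] := size_le_exists P; have [t Qt] := size_le_exists Q.
rewrite (wdot_moment (size_leX Ps) Qt) (wdot_moment Ps (size_leX Qt)).
rewrite big_ord_recl big1 ?add0r => [|b _]; last by rewrite mxcoefX !mul0mx.
apply: eq_bigr => a _; rewrite [RHS]big_ord_recl /= (mxcoefX 0 Q).
rewrite trmx0 map_mx0 mulmx0 add0r; apply: eq_bigr => b _.
by rewrite !mxcoefX /= /bump /= !add1n addSnnS.
Qed.

Lemma cintegrable_weight P Q i j :
  cintegrable (fun x => (mxeval P x *m W x *m (mxeval Q x)^t*) i j).
Proof.
have [s Ps] := size_le_exists P; have [t Qt] := size_le_exists Q.
rewrite (pairing_expand i j Ps Qt).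
by do 4![apply: cintegrable_sum => ?]; exact: cintegrable_pairing.
Qed.

Lemma weight_nonneg x (v : 'rV[C]_n) : 0 <= complex.Re ((v *m W x *m v^t*) 0 0).
Proof.
have [_ W0 _ Wpos _] := hW.
have [xI|/W0->] := boolP (x0 < x%:E < x1)%E; last by rewrite mulmx0 mul0mx mxE.
have [->|v0] := eqVneq v 0; first by rewrite !mul0mx mxE.
by have := Wpos x xI v v0; rewrite ltcE /= => /andP[_ /ltW].
Qed.

Lemma weight_pos x (v : 'rV[C]_n) : (x0 < x%:E < x1)%E -> v != 0 ->
  0 < complex.Re ((v *m W x *m v^t*) 0 0).
Proof.
have [_ _ _ Wpos _] := hW => xI v0.
by have := Wpos x xI v v0; rewrite ltcE /= => /andP[].
Qed.

Lemma support_interval : exists a b : R, a < b /\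
  forall x, a < x < b -> (x0 < x%:E < x1)%E.
Proof.
have [[x01 _] _ _ _ _] := hW; move: x01.
case: (x0) (x1) => [r| |] [r'| |] //=; rewrite ?lte_fin => rr'.
- by exists r, r'; split=> // x; rewrite !lte_fin.
- by exists r, (r + 1); split=> [|x /andP[rx _]]; rewrite ?ltrDl // lte_fin rx ltry.
- by exists (r' - 1), r'; split=> [|x /andP[_ xr]]; rewrite ?ltrBlDr ?ltrDl // lte_fin xr ltNyr.
- by exists 0, 1; split=> // x _; rewrite ltNyr ltry.
Qed.

Lemma real_roots_countable (p : {poly C}) : p != 0 ->
  countable [set x : R | p.[x%:C%C] = 0]%classic.
Proof.
move=> p0; have [r pE] := closed_field_poly_normal p.
apply: finite_set_countable.
apply: (@sub_finite_set _ _ [set complex.Re z | z in [set` r]]%classic); last first.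
  exact/finite_image/finite_seq.
move=> x /= px; exists x%:C%C => //=.
have /eqP := px; rewrite -/(root p _) pE rootZ ?lead_coef_eq0 //.
by rewrite root_prod_XsubC.
Qed.

(** The diagonal entries of the integrand are nonnegative, and if a row of P is not
    zero then the corresponding entry is positive on the support of W outside the
    roots of some polynomial.  An integral equal to zero would make an interval the
    union of two negligible sets. *)
Lemma wdot_definite P : wdot W P P = 0 -> P = 0.
Proof.
move=> PP0; apply/eqP; apply: contraT => /eqP P0.
have [i [j pij]] : exists i j, P i j != 0.
  apply: contrapT => H; apply: P0; apply/matrixP => i j; rewrite mxE.
  by apply: contrapT => /eqP pij; apply: H; exists i, j.
pose v x := row i (mxeval P x).
pose g x := complex.Re ((v x *m W x *m (v x)^t*) 0 0).
have gE x : g x = complex.Re ((mxeval P x *m W x *m (mxeval P x)^t*) i i).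
  congr complex.Re; rewrite /v -row_mul !mxE; apply: eq_bigr => k _.
  by rewrite !mxE.
have [gI _] := cintegrable_weight P P i i.
have {}gI : (@lebesgue_measure R).-integrable setT (fun x => (g x)%:E).
  by apply: eq_integrable gI => // x _; rewrite gE.
have g0 : (\int[lebesgue_measure]_x (g x)%:E = 0)%E.
  rewrite -[LHS]fineK ?integrable_fin_num //.
  move/matrixP/(_ i i): PP0; rewrite !mxE => /(congr1 (@complex.Re R)) /= e.
  suff -> : fine (\int[lebesgue_measure]_x (g x)%:E) = 0 by [].
  by rewrite -[RHS]e; congr fine; apply: eq_integral => x _; rewrite gE.
have mg := measurable_int _ gI.
have : (\int[lebesgue_measure]_x `|(g x)%:E| = 0)%E.
  rewrite -[RHS]g0; apply: eq_integral => x _.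
  by rewrite gee0_abs // lee_fin weight_nonneg.
move/(ae_eq_integral_abs _ measurableT mg) => g_ae.
have [a [b [ab abI]]] := support_interval.
have : (@lebesgue_measure R).-negligible `]a, b[%classic.
  apply: (negligibleS _ (negligibleU g_ae _)); last first.
    by apply/negligibleP; [exact: countable_measurable (real_roots_countable pij) | exact: countable_lebesgue_measure0 (real_roots_countable pij)].
  move=> x /=; rewrite in_itv /= => xab.
  have [px|px] := eqVneq ((P i j).[x%:C%C]) 0; [by right|left].
  move=> /(_ Logic.I) /= [] /eqP; rewrite gt_eqF // weight_pos ?abI //.
  by apply: contraNneq px => /rowP/(_ j); rewrite !mxE => ->.
case=> B [mB B0 abB].
have : (lebesgue_measure `]a, b[%classic <= lebesgue_measure B)%E.
  by apply: le_measure; rewrite ?inE //; exact: measurable_itv.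
rewrite B0 lebesgue_measure_itv /= lte_fin ab.
by rewrite -EFinB lee_fin subr_le0 leNgt ab.
Qed.

End Moments.

(** * Orthogonal polynomials *)

Section MonicFamilies.
Variables (K : comNzRingType) (n : nat).
Implicit Types (P Q : 'M[{poly K}]_n).

Definition mxmonic (m : nat) P : Prop := mxcoef m P = 1%:M /\ size_le m.+1 P.

Lemma mxmonicXn m : mxmonic m ('X^m *: 1%:M).
Proof.
split=> [|i j]; first apply/matrixP => i j; rewrite !mxE; case: (i == j).
- by rewrite mulr1 coefXn eqxx.
- by rewrite mulr0 coef0.
- by rewrite mulr1 size_polyXn.
by rewrite mulr0 size_poly0.
Qed.

Lemma size_le_sub_lead m P Q : mxmonic m P -> size_le m.+1 Q ->
  size_le m (Q - map_mx polyC (mxcoef m Q) *m P).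
Proof.
move=> [Pm Ps] Qs; apply/size_le_coef => k; rewrite leq_eqVlt => /orP[/eqP<-|mk].
  by rewrite mxcoefB mxcoef_constl Pm mulmx1 subrr.
have /size_le_coef/(_ k mk) := Qs; have /size_le_coef/(_ k mk) := Ps.
by rewrite mxcoefB mxcoef_constl => -> ->; rewrite mulmx0 subr0.
Qed.

Lemma size_le0 Q : size_le 0 Q -> Q = 0.
Proof. by move=> /size_le_coef Q0; apply: mxcoef_inj => k; rewrite Q0 //; apply/matrixP => i j; rewrite !mxE coef0. Qed.

(** Monic families of all degrees span: subtracting the leading coefficient times the
    monic polynomial of that degree lowers the size. *)
Lemma monic_family_ind (P : nat -> 'M[{poly K}]_n) (H : 'M[{poly K}]_n -> Prop) k :
    (forall m, (m < k)%N -> mxmonic m (P m)) -> H 0 ->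
    (forall m L Q, (m < k)%N -> H Q -> H (map_mx polyC L *m P m + Q)) ->
  forall Q, size_le k Q -> H Q.
Proof.
elim: k => [|k IHk] Pm H0 HD Q Qs; first by rewrite (size_le0 Qs).
have {}IHk : forall Q, size_le k Q -> H Q.
  by apply: IHk => // [m mk|m L Q' mk]; [apply/Pm/ltnW|apply/HD/ltnW].
rewrite -[Q](subrKC (map_mx polyC (mxcoef k Q) *m P k)).
apply: HD => //; apply: IHk; exact: size_le_sub_lead (Pm _ _) Qs.
Qed.

End MonicFamilies.

Section OrthogonalPolynomials.
Variables (R : realType) (n : nat) (x0 x1 : \bar R) (W : R -> 'M[R[i]]_n).
Hypothesis hW : weight_matrix x0 x1 W.
Local Notation C := R[i].
Local Open Scope sesquilinear_scope.
Implicit Types (P Q : 'M[{poly C}]_n) (L : 'M[C]_n).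

Lemma wdot0l Q : wdot W 0 Q = 0.
Proof. by have := wdot_constl hW 0 0 Q; rewrite mulmx0 mul0mx. Qed.

Lemma wdot0r P : wdot W P 0 = 0.
Proof. by rewrite (wdot_herm hW 0 P) wdot0l trmx0 map_mx0. Qed.

Lemma wdotDr P Q Q' : wdot W P (Q + Q') = wdot W P Q + wdot W P Q'.
Proof. by rewrite (wdot_herm hW (Q + Q') P) (wdotDl hW) [(_ + _)^T]linearD map_mxD
  (wdot_herm hW Q P) (wdot_herm hW Q' P). Qed.

Lemma wdotNl P Q : wdot W (- P) Q = - wdot W P Q.
Proof. by apply/eqP; rewrite -addr_eq0 -(wdotDl hW) addNr wdot0l. Qed.

Lemma wdotNr P Q : wdot W P (- Q) = - wdot W P Q.
Proof. by apply/eqP; rewrite -addr_eq0 -wdotDr addNr wdot0r. Qed.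

Lemma wdotBl P P' Q : wdot W (P - P') Q = wdot W P Q - wdot W P' Q.
Proof. by rewrite (wdotDl hW) wdotNl. Qed.

Lemma wdotBr P Q Q' : wdot W P (Q - Q') = wdot W P Q - wdot W P Q'.
Proof. by rewrite wdotDr wdotNr. Qed.

Lemma wdot_constr L P Q : wdot W P (map_mx polyC L *m Q) = wdot W P Q *m L^t*.
Proof.
by rewrite (wdot_herm hW _ P) (wdot_constl hW) trmx_mul map_mxM /= -(wdot_herm hW Q P).
Qed.

Lemma wdot_suml (I : Type) (s : seq I) (F : I -> 'M[{poly C}]_n) Q :
  wdot W (\sum_(i <- s) F i) Q = \sum_(i <- s) wdot W (F i) Q.
Proof. exact: (big_morph (fun P => wdot W P Q) (fun P P' => wdotDl hW P P' Q) (wdot0l Q)). Qed.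

Lemma wdot_inj P P' : (forall Q, wdot W Q P = wdot W Q P') -> P = P'.
Proof.
move=> e; apply/eqP; rewrite -subr_eq0; apply/eqP/(wdot_definite hW).
by rewrite wdotBr e subrr.
Qed.

(** A row in the kernel of the Gram matrix gives a combination of the rows of P of
    norm zero, and P has invertible leading coefficient. *)
Lemma gram_unitmx m P : mxmonic m P -> wdot W P P \in unitmx.
Proof.
move=> [Pm _]; rewrite -row_free_unit; apply: inj_row_free => v v0.
pose L : 'M[C]_n := \matrix_i v.
have LP0 : map_mx polyC L *m P = 0.
  apply: (wdot_definite hW); rewrite (wdot_constl hW) wdot_constr mulmxA.
  suff -> : L *m wdot W P P = 0 by rewrite mul0mx.
  by apply/row_matrixP => i; rewrite row_mul rowK v0 row0.
have /matrixP L0 : L = 0.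
  rewrite -[L]mulmx1 -Pm -mxcoef_constl LP0.
  by apply/matrixP => i j; rewrite !mxE coef0.
by apply/rowP => j; have := L0 j j; rewrite !mxE.
Qed.

Lemma orthogonal_lower (P : nat -> 'M[{poly C}]_n) m Q :
    (forall l, (l < m)%N -> mxmonic l (P l)) ->
    (forall l, (l < m)%N -> wdot W Q (P l) = 0) ->
  forall Q', size_le m Q' -> wdot W Q Q' = 0.
Proof.
move=> Pm QP; apply: (monic_family_ind Pm) => [|l L Q' lm Q'0]; first exact: wdot0r.
by rewrite wdotDr Q'0 wdot_constr QP // mul0mx addr0.
Qed.

(** Gram-Schmidt with matrix coefficients, based on the invertibility of the Gram
    matrices. *)
Lemma orthogonal_monic_exists m : exists P, mxmonic m P /\
  forall Q, size_le m Q -> wdot W P Q = 0.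
Proof.
elim/ltn_ind: m => m IHm.
have [P PP] : exists P : nat -> 'M[{poly C}]_n, forall l, (l < m)%N ->
    mxmonic l (P l) /\ forall Q, size_le l Q -> wdot W (P l) Q = 0.
  have H l : exists P, (l < m)%N ->
      mxmonic l P /\ forall Q, size_le l Q -> wdot W P Q = 0.
    by have [/IHm[P]|] := boolP (l < m)%N; [exists P|exists 0].
  by have [P PH] := choice H; exists P.
have P_orth k l : (k < m)%N -> (l < m)%N -> k != l -> wdot W (P k) (P l) = 0.
  move=> km lm; rewrite neq_ltn => /orP[kl|lk].
    rewrite (wdot_herm hW) (PP _ lm).2 ?trmx0 ?map_mx0 //.
    exact: size_leW kl (PP _ km).1.2.
  by apply: (PP _ km).2; exact: size_leW lk (PP _ lm).1.2.
pose Xm : 'M[{poly C}]_n := 'X^m *: 1%:M.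
pose c l := wdot W Xm (P l) *m invmx (wdot W (P l) (P l)).
pose Q := Xm - \sum_(l < m) map_mx polyC (c l) *m P l.
have sum_size : size_le m (\sum_(l < m) map_mx polyC (c l) *m P l).
  elim/big_rec: _ => [|l Q' _ Q's].
    by move=> i j; rewrite mxE size_poly0.
  apply: size_leD => //; apply: size_le_constl.
  exact: size_leW (ltn_ord l) (PP _ (ltn_ord l)).1.2.
have [Xm1 Xm2] := mxmonicXn C n m.
exists Q; split; first split.
- rewrite mxcoefB Xm1; have /size_le_coef/(_ m (leqnn m)) -> := sum_size.
  by rewrite subr0.
- by apply/size_leD => //; apply/size_leN/(size_leW (leqnSn m)).
apply: (@orthogonal_lower P) => [l lm|l lm]; first exact: (PP l lm).1.
rewrite wdotBl wdot_suml (bigD1 (Ordinal lm)) //= big1 => [|k kl].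
  rewrite (wdot_constl hW) /c mulmxKV ?addr0 ?subrr //.
  exact: gram_unitmx (PP l lm).1.
rewrite (wdot_constl hW) P_orth ?mulmx0 //.
Qed.

Lemma monicOP_orthogonal : monic_orthogonal W (monicOP W).
Proof.
have [P PP] := choice orthogonal_monic_exists.
apply: (@xgetPex _ _ [set P | monic_orthogonal W P]%classic); exists P; split.
- by move=> m; have [[]] := PP m.
- by move=> m; have [[]] := PP m.
move=> m l; rewrite neq_ltn => /orP[ml|lm].
  rewrite (wdot_herm hW) (PP l).2 ?trmx0 ?map_mx0 //.
  exact: size_leW ml (PP m).1.2.
by apply: (PP m).2; exact: size_leW lm (PP l).1.2.
Qed.

Lemma monicOP_monic m : mxmonic m (monicOP W m).
Proof. by have [H1 H2 _] := monicOP_orthogonal; split; [exact: H1|exact: H2]. Qed.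

Lemma monicOP_orth m l : m != l -> wdot W (monicOP W m) (monicOP W l) = 0.
Proof. by have [_ _ H] := monicOP_orthogonal; apply: H. Qed.

Lemma monicOP_ind (H : 'M[{poly C}]_n -> Prop) : H 0 ->
  (forall m L Q, H Q -> H (map_mx polyC L *m monicOP W m + Q)) -> forall Q, H Q.
Proof.
move=> H0 HD Q; have [k Qk] := size_le_exists Q.
by apply: (monic_family_ind _ H0 _ Qk) => [m _|m L Q' _]; [exact: monicOP_monic|exact: HD].
Qed.

End OrthogonalPolynomials.

(** * Adjoints of differential operators *)

Section DifferentialOperators.
Variables (K : numFieldType) (n : nat).
Implicit Types (P Q : 'M[{poly K}]_n) (D E : 'M[weyl K]_n) (F G : 'M[{poly K}]_n -> 'M[{poly K}]_n).

Lemma mxactDl P Q D : mxact (P + Q) D = mxact P D + mxact Q D.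
Proof.
apply/matrixP => i k; rewrite !mxE -big_split; apply: eq_bigr => j _ /=.
by rewrite mxE wactDl.
Qed.

Lemma mxact0l D : mxact 0 D = 0.
Proof. by apply/matrixP => i k; rewrite !mxE big1 // => j _; rewrite mxE wact0l. Qed.

Lemma mxactDr P D E : mxact P (D + E) = mxact P D + mxact P E.
Proof.
apply/matrixP => i k; rewrite !mxE -big_split; apply: eq_bigr => j _ /=.
by rewrite mxE wactDr.
Qed.

(** Commutation with multiplication by x is formal differentiation with respect to the
    symbol of the derivation, because (x f)^(j) = x f^(j) + j f^(j-1). *)
Lemma wact_mulX (f : {poly K}) (d : weyl K) :
  wact ('X * f) d = 'X * wact f d + wact f (deriv (d : {poly {poly K}}) : weyl K).
Proof.
have derivnX (g : {poly K}) j : derivn j ('X * g) = 'X * derivn j g + derivn j.-1 g *+ j.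
  case: j => [|j]; first by rewrite mulr0n addr0.
  have := derivnMXaddC j g 0; rewrite addr0 mulrC => ->.
  by rewrite addrC [in RHS]mulrC.
pose m := size (d : {poly {poly K}}); have dm : (size (d : {poly {poly K}}) <= m.+1)%N by [].
rewrite !(wactE _ dm) mulr_sumr.
have d'm : (size (deriv (d : {poly {poly K}})) <= m)%N.
  exact: leq_trans (size_poly _ _) (leq_pred _).
rewrite (wactE f d'm).
transitivity (\sum_(j < m.+1) 'X * (derivn j f * wcoef d j) +
    \sum_(j < m.+1) derivn j.-1 f * wcoef d j *+ j).
  rewrite -big_split; apply: eq_bigr => j _ /=.
  by rewrite derivnX mulrDl mulrA mulrnAl.
congr (_ + _); rewrite big_ord_recl mulr0n add0r; apply: eq_bigr => j _.
by rewrite /wcoef coef_deriv mulrnAr.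
Qed.

Definition mxderiv D : 'M[weyl K]_n :=
  map_mx (fun d : weyl K => deriv (d : {poly {poly K}}) : weyl K) D.

(** The commutator with multiplication by x. *)
Definition nabla F : 'M[{poly K}]_n -> 'M[{poly K}]_n :=
  fun Q => 'X *: F Q - F ('X *: Q).

Lemma nabla_mxact D Q : nabla (fun P => mxact P D) Q = - mxact Q (mxderiv D).
Proof.
apply/matrixP => i k; rewrite !mxE mulr_sumr -sumrB -sumrN; apply: eq_bigr => j _.
by rewrite !mxE wact_mulX opprD addNKr.
Qed.

Definition mxlinear F : Prop := (forall P Q, F (P + Q) = F P + F Q) /\
  forall (L : 'M[K]_n) P, F (map_mx polyC L *m P) = map_mx polyC L *m F P.

Lemma mxlinear_nabla F : mxlinear F -> mxlinear (nabla F).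
Proof.
move=> [FD FL]; split=> [P Q|L P]; rewrite /nabla.
  by rewrite FD !scalerDr FD opprD addrACA.
by rewrite FL !scalemxAr FL mulmxBr.
Qed.

Lemma mxlinear_mxact D : mxlinear (fun P => mxact P D).
Proof. by split=> [P Q|L P]; rewrite ?mxactDl // mxact_constl. Qed.

Lemma mxlinearB F G : mxlinear F -> mxlinear G -> mxlinear (fun P => F P - G P).
Proof.
move=> [FD FL] [GD GL]; split=> [P Q|L P]; first by rewrite FD GD opprD addrACA.
by rewrite FL GL mulmxBr.
Qed.

Lemma mxlinear0 F : mxlinear F -> F 0 = 0.
Proof. by move=> [FD _]; apply: (addrI (F 0)); rewrite -FD !addr0. Qed.

(** Antiderivatives exist in characteristic zero. *)
Lemma mxderiv_surj D : exists E, mxderiv E = D.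
Proof.
pose int (d : weyl K) : weyl K := \poly_(i < (size (d : {poly {poly K}})).+1)
  ((i%:R^-1)%:P * (d : {poly {poly K}})`_i.-1).
exists (map_mx int D); apply/matrixP => i j; rewrite !mxE; apply/polyP => k.
rewrite coef_deriv coef_poly ltnS; case: ltnP => [_|dk].
  rewrite -mulrnAl -polyCMn.
  by rewrite -[X in X%:P]mulr_natr mulVf ?mul1r // pnatr_eq0.
by rewrite mul0rn nth_default.
Qed.

Definition order0 (L : 'M[{poly K}]_n) : 'M[weyl K]_n :=
  map_mx (fun p => (p%:P : weyl K)) L.

Lemma mxact_order0 P (L : 'M[{poly K}]_n) : mxact P (order0 L) = P *m L.
Proof.
apply/matrixP => i k; rewrite !mxE; apply: eq_bigr => j _; rewrite mxE.
by rewrite (wactE _ (size_polyC_leq1 _)) big_ord1 /wcoef coefC.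
Qed.

(** Such a map is linear over all matrix polynomials, acting from the left. *)
Lemma commutes_with_X F : mxlinear F -> (forall Q, nabla F Q = 0) ->
  forall Q, F Q = Q *m F 1%:M.
Proof.
move=> lF F0; have FX m : F ('X^m *: 1%:M) = 'X^m *: F 1%:M.
  elim: m => [|m IHm]; first by rewrite !scale1r.
  rewrite exprS -!scalerA -IHm; apply/esym/eqP; rewrite -subr_eq0; apply/eqP.
  exact: F0.
move=> Q; have [k Qk] := size_le_exists Q.
apply: (@monic_family_ind K n (fun m => 'X^m *: 1%:M) (fun Q => F Q = Q *m F 1%:M) k
  _ _ _ Q Qk) => [m _||m L Q' _ IH].
- exact: mxmonicXn.
- by rewrite mul0mx mxlinear0.
rewrite lF.1 lF.2 IH mulmxDl FX; congr (_ + _).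
by rewrite -!scalemxAr -scalemxAl mulmx1.
Qed.

Lemma mxactNr P D : mxact P (- D) = - mxact P D.
Proof.
by apply/matrixP => i k; rewrite !mxE -sumrN; apply: eq_bigr => j _; rewrite mxE wactNr.
Qed.

Lemma iter_nabla_mxact s D : (forall i j, (size (D i j : {poly {poly K}}) <= s)%N) ->
  forall Q, iter s nabla (fun P => mxact P D) Q = 0.
Proof.
elim: s D => [|s IHs] D Ds Q.
  rewrite /= (_ : D = 0) => [|]; last first.
    by apply/matrixP => i j; rewrite mxE; apply/eqP; rewrite -size_poly_leq0.
  by apply/matrixP => i k; rewrite !mxE big1 // => j _; rewrite mxE wact0r.
rewrite iterSr (_ : nabla _ = fun P => mxact P (- mxderiv D)).
  apply: IHs => i j; rewrite !mxE size_polyN.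
  by rewrite (leq_trans (size_poly _ _)) // -subn1 leq_subLR add1n.
by apply/funext => P; rewrite nabla_mxact mxactNr.
Qed.

(** By induction on s, the commutator of F is a differential operator.  Subtracting
    from F an antiderivative of it leaves a map that commutes with multiplication by x,
    that is, an operator of order zero. *)
Lemma differential_operator s F : mxlinear F -> (forall Q, iter s nabla F Q = 0) ->
  exists E, forall Q, F Q = mxact Q E.
Proof.
elim: s F => [|s IHs] F lF F0.
  exists 0 => Q; rewrite [LHS]F0; apply/matrixP => i k; rewrite !mxE big1 // => j _.
  by rewrite mxE wact0r.
have [|Q|E1 E1F] := IHs (nabla F); first exact: mxlinear_nabla.
  by rewrite -iterSr.
have [E2 E2E] := mxderiv_surj (- E1).
pose G Q := F Q - mxact Q E2.
have lG : mxlinear G by apply: mxlinearB (mxlinear_mxact _).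
have G0 Q : nabla G Q = 0.
  have -> : nabla G Q = nabla F Q - nabla (fun P => mxact P E2) Q.
    by rewrite /nabla /G scalerBr !opprD !opprK addrACA.
  by rewrite nabla_mxact E1F E2E mxactNr !opprK subrr.
exists (E2 + order0 (G 1%:M)) => Q; rewrite mxactDr mxact_order0 -(commutes_with_X lG G0).
by rewrite subrKC.
Qed.

End DifferentialOperators.
Arguments nabla {K n} F Q.

Section Adjoint.
Variables (R : realType) (n : nat) (x0 x1 : \bar R) (W : R -> 'M[R[i]]_n).
Hypothesis hW : weight_matrix x0 x1 W.
Local Notation C := R[i].
Local Open Scope sesquilinear_scope.
Implicit Types (P Q : 'M[{poly C}]_n) (L : 'M[C]_n) (D E : 'M[weyl C]_n)
  (F G : 'M[{poly C}]_n -> 'M[{poly C}]_n).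

Definition wadjoint F G : Prop := forall P Q, wdot W (F P) Q = wdot W P (G Q).

(** Multiplication by x is self-adjoint, so the adjoint of a commutator is minus the
    commutator of the adjoint. *)
Lemma wadjoint_nabla F G : wadjoint F G -> wadjoint (nabla F) (fun Q => - nabla G Q).
Proof.
move=> FG P Q; rewrite /nabla (wdotBl hW) (wdotX hW) !FG (wdotX hW) -(wdotBr hW).
by rewrite opprB.
Qed.

Lemma wadjoint_linear F G : wadjoint F G -> mxlinear G.
Proof.
move=> FG; split=> [P Q|L P]; apply: (wdot_inj hW) => P'.
  by rewrite (wdotDr hW) -!FG (wdotDr hW).
by rewrite (wdot_constr hW) -!FG (wdot_constr hW).
Qed.

Lemma nablaN F Q : nabla (fun P => - F P) Q = - nabla F Q.
Proof. by rewrite /nabla scalerN opprB opprK addrC. Qed.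

Lemma wadjoint_iter_nabla s F G : wadjoint F G -> (forall Q, iter s nabla F Q = 0) ->
  forall Q, iter s nabla G Q = 0.
Proof.
elim: s F G => [|s IHs] F G FG F0 Q.
  by apply: (wdot_inj hW) => P; rewrite -FG (F0 : forall Q, F Q = 0) (wdot0l hW) (wdot0r hW).
have iterN m (H : 'M[{poly C}]_n -> 'M[{poly C}]_n) : 
    iter m nabla (fun P => - H P) = fun P => - iter m nabla H P.
  by elim: m => //= m ->; apply/funext => P; rewrite nablaN.
have := IHs _ _ (wadjoint_nabla FG); rewrite -iterSr iterN => /(_ F0 Q)/eqP.
by rewrite oppr_eq0 -iterSr => /eqP.
Qed.

(** On P(x, m), whose Gram matrix is S, the adjoint of an operator with eigenvalue
    Lambda(m) acts by the adjoint of S^-1 Lambda(m) S.  Expanding in the P(x, m) gives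
    an adjoint on all polynomials, and it is a differential operator because its
    iterated commutators with x vanish when those of D do. *)
Lemma bispectral_adjoint D : D \in bispectral W ->
  exists2 E, E \in bispectral W & wadjoint (fun P => mxact P D) (fun Q => mxact Q E).
Proof.
move=> /asboolP[La DLa]; pose p := monicOP W; pose S m := wdot W (p m) (p m).
have SU m : S m \in unitmx by exact: (gram_unitmx hW) (monicOP_monic hW m).
pose Ga m := (invmx (S m) *m La m *m S m)^t*.
have eigen m P : wdot W (mxact P D) (p m) = wdot W P (map_mx polyC (Ga m) *m p m).
  elim/(monicOP_ind hW): P => [|l L P IH]; first by rewrite mxact0l !(wdot0l hW).
  rewrite mxactDl !(wdotDl hW) IH mxact_constl DLa !(wdot_constl hW); congr (_ *m _ + _).
  rewrite (wdot_constr hW) trmxCK; have [->|lm] := eqVneq l m.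
    by rewrite -/(S m) (mulmxA (S m)) (mulmxA (S m)) (mulmxV (SU m)) mul1mx //.
  have -> : wdot W (p l) (p m) = 0 := monicOP_orth hW lm.
  by rewrite mulmx0 mul0mx.
have /choice[G FG] Q : exists T, forall P, wdot W (mxact P D) Q = wdot W P T.
  elim/(monicOP_ind hW): Q => [|m L Q [T QT]].
    by exists 0 => P; rewrite !(wdot0r hW).
  exists (map_mx polyC L *m (map_mx polyC (Ga m) *m p m) + T) => P.
  by rewrite !(wdotDr hW) QT !(wdot_constr hW L) eigen.
have {}FG : wadjoint (fun P => mxact P D) G by move=> P Q; exact: FG.
have [s Ds] : exists s, forall i j, (size (D i j : {poly {poly C}}) <= s)%N.
  exists (\max_i \max_j size (D i j : {poly {poly C}}))%N => i j.
  by rewrite (leq_trans _ (leq_bigmax i)) // (leq_bigmax j).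
have [E GE] := differential_operator (wadjoint_linear FG)
  (wadjoint_iter_nabla FG (iter_nabla_mxact Ds)).
exists E; last by move=> P Q; rewrite FG GE.
apply/asboolP; exists Ga => m; apply: (wdot_inj hW) => P.
by rewrite -GE -FG eigen.
Qed.

Lemma mxact_inj D E : (forall P, mxact P D = mxact P E) -> D = E.
Proof.
move=> DE; apply/matrixP => i j; apply: wact_inj => f.
have row_act (B : 'M[weyl C]_n) : mxact (f *: delta_mx i i) B i j = wact f (B i j).
  rewrite mxE (bigD1 i) //= big1 ?addr0 => [|k ki].
    by rewrite !mxE !eqxx mulr1.
  by rewrite !mxE (negPf ki) andbF mulr0 wact0l.
by rewrite -!row_act DE.
Qed.

End Adjoint.

Section AdjointAlgebra.
Variables (R : realType) (n : nat) (x0 x1 : \bar R) (W : R -> 'M[R[i]]_n.+1).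
Hypothesis hW : weight_matrix x0 x1 W.

Lemma DW_inj (D E : DW W) : (forall P, mxact P D = mxact P E) -> D = E.
Proof. by move=> DE; apply/val_inj/mxact_inj. Qed.

Lemma mxact_mul (D E : DW W) P : mxact P (D * E : DW W) = mxact (mxact P D) E.
Proof. exact: mxactM. Qed.

Lemma adjoint_algebra : exists adj : DW W -> DW W,
  [/\ {morph adj : D E / D + E}, forall D E, adj (D * E) = adj E * adj D,
      involutive adj, forall D, D * adj D = 0 -> D = 0
    & forall D, Wsymmetric D <-> adj D = D].
Proof.
have H (D : DW W) : exists E : DW W,
    forall P Q, wdot W (mxact P D) Q = wdot W P (mxact Q E).
  have [E EW DE] := bispectral_adjoint hW (valP D).
  by exists (MkDW EW) => P Q; apply: DE.
have [adj adjE] := choice H.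
have adj_uniq (D E : DW W) : (forall P Q, wdot W (mxact P D) Q = wdot W P (mxact Q E)) ->
    adj D = E.
  by move=> DE; apply: DW_inj => Q; apply: (wdot_inj hW) => P; rewrite -adjE DE.
have adj_sym D P Q : wdot W (mxact P (adj D)) Q = wdot W P (mxact Q D).
  by rewrite (wdot_herm hW) -adjE -(wdot_herm hW).
exists adj; split=> [D E|D E|D|D D0|D].
- by apply: adj_uniq => P Q; rewrite !mxactDr (wdotDl hW) (wdotDr hW) !adjE.
- by apply: adj_uniq => P Q; rewrite !mxact_mul !adjE.
- by apply: adj_uniq => P Q; rewrite adj_sym.
- apply: DW_inj => P; have act0 Q : mxact Q (0 : DW W) = 0.
    by apply/matrixP => i k; rewrite !mxE big1 // => j _; rewrite mxE wact0r.
  by rewrite act0; apply: (wdot_definite hW); rewrite adjE -mxact_mul D0 act0 (wdot0r hW).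
split=> [Ds|aD P Q]; first exact: adj_uniq.
by rewrite -[in RHS]aD adjE.
Qed.

End AdjointAlgebra.

(** * The symbol of a bispectral operator *)

Section Symbol.
Variable K : numFieldType.
Implicit Types (f c : {poly K}) (d : weyl K).

(** The falling factorial t (t - 1) ... (t - l + 1). *)
Definition ffpoly (l : nat) : {poly K} := \prod_(i < l) ('X - (i%:R)%:P).

Lemma horner_ffpoly l m : (ffpoly l).[m%:R] = (m ^_ l)%:R.
Proof.
rewrite /ffpoly; elim: l => [|l IHl]; first by rewrite big_ord0 hornerC ffactn0.
rewrite big_ord_recr hornerM IHl hornerXsubC ffactnSr natrM.
have [lm|ml] := leqP l m; first by rewrite natrB.
by rewrite ffact_small // !mul0r.
Qed.

(** The polynomial in t whose value at m is the factor by which d multiplies the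
    coefficient of x^m in polynomials of degree m, when the coefficient of the l-th
    derivative has degree at most l. *)
Definition symbol d : {poly K} :=
  \sum_(l < size (d : {poly {poly K}})) (wcoef d l)`_l *: ffpoly l.

Definition degree_bounded d : Prop := forall l, (size (wcoef d l) <= l.+1)%N.

(** Only the top coefficients of the two factors reach the degree m. *)
Lemma coef_derivn_mul l m f c : (size f <= m.+1)%N -> (size c <= l.+1)%N ->
  (derivn l f * c)`_m = f`_m * c`_l * (m ^_ l)%:R.
Proof.
move=> fm cl; rewrite coefM.
have f0 i : (m < l + i)%N -> (derivn l f)`_i = 0.
  by move=> mi; rewrite coef_derivn nth_default ?mul0rn // (leq_trans fm).
have [lm|ml] := leqP l m; last first.
  rewrite ffact_small // mulr0 big1 // => i _.
  by rewrite f0 ?mul0r // (leq_trans ml) // leq_addr.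
have lm' : (m - l < m.+1)%N by rewrite ltnS leq_subr.
rewrite (bigD1 (Ordinal lm')) //= big1 ?addr0 => [|i il].
  by rewrite coef_derivn subnKC // subKn // -mulr_natr; ring.
have [mi|] := ltnP m (l + i); first by rewrite f0 ?mul0r.
rewrite leq_eqVlt => /orP[/eqP e|lim].
  by case/eqP: il; apply/val_inj => /=; lia.
by rewrite (nth_default 0 (s := c)) ?mulr0 // (leq_trans cl) // ltn_subRL addnC.
Qed.

Lemma coef_wact_lead d f m : degree_bounded d -> (size f <= m.+1)%N ->
  (wact f d)`_m = f`_m * (symbol d).[m%:R].
Proof.
move=> dB fm; rewrite /wact coef_sum /symbol horner_sum mulr_sumr; apply: eq_bigr => l _.
by rewrite coef_derivn_mul // hornerZ horner_ffpoly mulrA.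
Qed.

Lemma poly_eq_nat (p q : {poly K}) : (forall m : nat, p.[m%:R] = q.[m%:R]) -> p = q.
Proof.
move=> e; apply/eqP; rewrite -subr_eq0; apply: contraT => pq0.
have := max_poly_roots pq0 (rs := [seq i%:R | i <- iota 0 (size (p - q))]).
rewrite size_map size_iota ltnn; apply.
  by apply/allP => _ /mapP[i _ ->]; rewrite rootE hornerD hornerN e subrr.
by rewrite map_inj_uniq ?iota_uniq // => i j /eqP; rewrite eqr_nat => /eqP.
Qed.

End Symbol.

Section BispectralSymbol.
Variables (R : realType) (n : nat) (x0 x1 : \bar R) (W : R -> 'M[R[i]]_n).
Hypothesis hW : weight_matrix x0 x1 W.
Local Notation C := R[i].
Implicit Types (Q : 'M[{poly C}]_n) (L : 'M[C]_n) (D : 'M[weyl C]_n).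

(** D multiplies each P(x, m) by a constant matrix, so it does not raise degrees. *)
Lemma bispectral_size_le D s : D \in bispectral W ->
  forall Q, size_le s Q -> size_le s (mxact Q D).
Proof.
move=> /asboolP[La DLa].
have Pm m : (m < s)%N -> mxmonic m (monicOP W m) by move=> _; exact: (monicOP_monic hW).
apply: (@monic_family_ind _ _ _ (fun Q => size_le s (mxact Q D)) s Pm) => [|m L Q' ms IH].
  by rewrite mxact0l => i j; rewrite mxE size_poly0.
rewrite mxactDl mxact_constl DLa; apply: size_leD => //.
by do 2!apply: size_le_constl; exact: size_leW ms (Pm m ms).2.
Qed.

(** Applied to x^j, the operator gives j! times its j-th coefficient plus terms that
    involve the lower coefficients, all of degree at most j by induction. *)
Lemma bispectral_degree_bounded D : D \in bispectral W -> forall i k, degree_bounded (D i k).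
Proof.
move=> bD i k; elim/ltn_ind => j IHj.
have Xj : size_le j.+1 ('X^j *: 1%:M : 'M[{poly C}]_n) := (mxmonicXn _ _ _).2.
have := bispectral_size_le bD Xj i k; rewrite mxE (bigD1 i) //= big1 ?addr0; last first.
  by move=> l li; rewrite !mxE eq_sym (negPf li) mulr0 wact0l.
rewrite !mxE eqxx mulr1; pose m := maxn j.+1 (size (D i k : {poly {poly C}})).
rewrite (@wactE _ m) ?leq_maxr //.
rewrite (bigD1 (Ordinal (leq_maxl j.+1 _ : j < m)%N)) //=.
rewrite derivnXn subnn expr0 ffactnn; set S := (X in _ + X) => H.
have sum_le : (size S <= j.+1)%N.
  apply: (leq_trans (size_sum _ _ _)); apply/bigmax_leqP => l lj.
  have [lt_lj|le_jl] := ltnP l j; last first.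
    rewrite derivnXn ffact_small ?mulr0n ?mul0r ?size_poly0 //.
    by rewrite ltn_neqAle le_jl andbT eq_sym; apply: contraNneq lj => e; apply/eqP/val_inj.
  rewrite derivnXn mulrnAl -(@scaler_nat C); apply: (leq_trans (size_scale_leq _ _)).
  apply: (leq_trans (size_polyMleq _ _)); rewrite size_polyXn /=.
  by rewrite (leq_trans (leq_add (leqnn _) (IHj l lt_lj))) // addnS subnK // ltnW.
have {}H : (size ((j`!)%:R * wcoef (D i k) j)%R <= j.+1)%N.
  rewrite -(addrK S (_ * _)%R).
  by rewrite (leq_trans (size_polyD _ _)) // size_polyN geq_max sum_le andbT.
by move: H; rewrite mulr_natl -(@scaler_nat C) size_scale //.
Qed.

Definition mxsymbol D : 'M[{poly C}]_n := map_mx (@symbol C) D.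

Definition mxvalue (m : nat) (L : 'M[{poly C}]_n) : 'M[C]_n := map_mx (fun p : {poly C} => p.[m%:R]) L.

Lemma mxvalue_symbol D m : D \in bispectral W ->
  mxact (monicOP W m) D = map_mx polyC (mxvalue m (mxsymbol D)) *m monicOP W m.
Proof.
move=> bD; have DB := bispectral_degree_bounded bD.
have [Pm Ps] := monicOP_monic hW m; have /asboolP[La DLa] := bD.
rewrite DLa; congr (map_mx _ _ *m _).
rewrite -[La m]mulmx1 -Pm -mxcoef_constl -DLa -[RHS]mul1mx -Pm.
apply/matrixP => i j; rewrite !mxE coef_sum; apply: eq_bigr => k _.
by rewrite coef_wact_lead // !mxE.
Qed.

Lemma mxvalue_inj (L L' : 'M[{poly C}]_n) : (forall m, mxvalue m L = mxvalue m L') -> L = L'.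
Proof.
move=> e; apply/matrixP => i j; apply: poly_eq_nat => m.
by have /matrixP/(_ i j) := e m; rewrite !mxE.
Qed.

Lemma symbol_uniq D (L : 'M[{poly C}]_n) : D \in bispectral W ->
    (forall m, mxact (monicOP W m) D = map_mx polyC (mxvalue m L) *m monicOP W m) ->
  mxsymbol D = L.
Proof.
move=> bD DL; apply: mxvalue_inj => m; have [Pm _] := monicOP_monic hW m.
rewrite -[LHS]mulmx1 -[RHS]mulmx1 -Pm -!mxcoef_constl -DL.
by rewrite -mxvalue_symbol.
Qed.

Lemma symbol_inj D E : D \in bispectral W -> E \in bispectral W ->
  mxsymbol D = mxsymbol E -> D = E.
Proof.
move=> bD bE DE; apply: mxact_inj => P.
elim/(monicOP_ind hW): P => [|m L Q IH]; first by rewrite !mxact0l.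
by rewrite !mxactDl !mxact_constl IH !mxvalue_symbol // DE.
Qed.

End BispectralSymbol.

Section Main.
Variables (R : realType) (n : nat) (x0 x1 : \bar R) (W : R -> 'M[R[i]]_n.+1).
Hypothesis hW : weight_matrix x0 x1 W.
Local Notation C := R[i].
Local Notation K := {fraction {poly R[i]}}.

(** A matrix of polynomials is determined by its values at the natural numbers, so the
    identities between eigenvalues become identities between symbols. *)
Lemma symbol_representation :
  exists rho : {rmorphism DW W -> 'M[K]_n.+1}, injective rho.
Proof.
pose rho (D : DW W) : 'M[K]_n.+1 := map_mx (@tofrac {poly C}) (mxsymbol D).
have act (D : DW W) m := mxvalue_symbol hW m (valP D).
have rhoB : zmod_morphism rho.
  move=> D E; rewrite /rho -map_mxB; congr map_mx; apply: (symbol_uniq hW) (valP _) _ => m.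
  rewrite [val (D - E)]/(val D - val E) mxactB !act -mulmxBl -map_mxB; congr (map_mx _ _ *m _).
  by apply/matrixP => i j; rewrite !mxE hornerD hornerN.
have rhoM : GRing.monoid_morphism rho.
  split=> [|D E].
    rewrite -[RHS](map_mx1 (@tofrac {poly C})); congr map_mx.
    apply: (symbol_uniq hW) (valP _) _ => m.
    rewrite [val 1]/(1%:M) mxact1 (_ : mxvalue m _ = 1%:M) ?map_mx1 ?mul1mx //.
    by apply/matrixP => i j; rewrite !mxE; case: (i == j); rewrite ?hornerC // horner0.
  rewrite -[RHS]/(_ *m _) /rho -map_mxM; congr map_mx.
  apply: (symbol_uniq hW) (valP _) _ => m.
  rewrite [val (D * E)]/(val D *m val E) mxactM act mxact_constl act mulmxA -map_mxM.
  congr (map_mx _ _ *m _); apply/matrixP => i j; rewrite !mxE horner_sum.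
  by apply: eq_bigr => k _; rewrite !mxE hornerM.
pose rhoB' := GRing.isZmodMorphism.Build _ _ rho rhoB.
pose rhoM' := GRing.isMonoidMorphism.Build _ _ rho rhoM.
pose F : {rmorphism DW W -> 'M[K]_n.+1} := HB.pack rho rhoB' rhoM'.
exists F => D E /matrixP e; apply/val_inj/(symbol_inj hW (valP D) (valP E)).
by apply/matrixP => i j; have := e i j; rewrite !mxE => /eqP; rewrite tofrac_eq => /eqP.
Qed.

End Main.

Theorem theorem4p22 (R : realType) (n : nat) (x0 x1 : \bar R)
    (W : R -> 'M[R[i]]_n.+1) (hW : weight_matrix x0 x1 W) :
  full (DW W) n.+1 <->
  exists V : 'I_n.+1 -> DW W,
    [/\ forall i, Wsymmetric (V i),
        forall i, V i != 0,
        forall i j, i != j -> V i * V j = 0,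
        \sum_i V i \in central (DW W)
      & GRing.lreg (\sum_i V i) /\ GRing.rreg (\sum_i V i)].
Proof.
have [adj [adjD adjM adjK adj_def symE]] := adjoint_algebra hW.
have [rho rho_inj] := symbol_representation hW.
rewrite (full_iff_orthogonal_symmetric adjD adjM adjK adj_def rho_inj).
split=> -[V].
  case=> [[Vs V0 Vo] VC Vr]; exists V.
  by split; [move=> i; exact: (symE (V i)).2 | exact: V0 | exact: Vo | exact: VC | exact: Vr].
case=> [Vs V0 Vo VC Vr]; exists V; split; [split | exact: VC | exact: Vr].
- by move=> i; exact: (symE (V i)).1.
- exact: V0.
exact: Vo.
Qed.
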